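(* Let $\alpha,\beta\in\mathbb{R}$ and let $a,b,\sigma\in\mathbb{R}$ satisfy $b>2a>0$ and $\sigma\neq0$, and consider the random dynamical system $\varphi$ generated by the stochastic differential equation described in the context. Then for any $z\in\mathbb{R}^2$, the finite-time Lyapunov exponents of solutions starting in $z$ can be arbitrarily large and arbitrarily small with positive probability. More precisely, there exists a $T>0$ such that for all $t\in(0,T]$ we have $$\operatorname*{ess\,sup}_{\omega\in\Omega}\ \sup_{\|v\|=1}\frac1t\ln\|\mathrm{D}\varphi(t,\omega,z)v\|=\infty\quad\text{and}\quad\operatorname*{ess\,inf}_{\omega\in\Omega}\ \inf_{\|v\|=1}\frac1t\ln\|\mathrm{D}\varphi(t,\omega,z)v\|=-\infty .$$
   Context: The equation is $\mathrm{d}Z_t=f(Z_t)\,\mathrm{d}t+\sigma\,\mathrm{d}W_t$ on $\mathbb{R}^2$, where for $Z=(x,y)^\top$ $$f(Z)=\begin{pmatrix}\alpha&-\beta\\ \beta&\alpha\end{pmatrix}Z-(x^2+y^2)\begin{pmatrix}a&-b\\ b&a\end{pmatrix}Z .$$ Probability space: $\Omega=C_0(\mathbb{R},\mathbb{R}^2)$ (continuous $\omega:\mathbb{R}\to\mathbb{R}^2$ with $\omega(0)=0$, compact-open topology), with its Borel $\sigma$-algebra and the two-sided Wiener measure $\mathbb{P}$; $W_t(\omega)=\omega(t)$. The solution $\varphi$ satisfies $\varphi(t,\omega,Z)=Z+\int_0^t f(\varphi(s,\omega,Z))\,\mathrm{d}s+\sigma\omega(t)$ for all $t\ge0$ (on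 a full-measure set identified with $\Omega$). $\mathrm{D}\varphi(t,\omega,z)$ denotes the derivative of $\varphi(t,\omega,\cdot)$ at $z$; it solves $\frac{\mathrm{d}}{\mathrm{d}t}\mathrm{D}\varphi(t,\omega,z)=\mathrm{D}f(\varphi(t,\omega,z))\,\mathrm{D}\varphi(t,\omega,z)$ with $\mathrm{D}\varphi(0,\omega,z)=\mathrm{Id}$. Essential suprema and infima are with respect to $\mathbb{P}$. *)

(* Defs.v *)
From HB Require Import structures.
From mathcomp Require Import all_boot all_order all_algebra.
From mathcomp Require Import all_classical all_reals all_analysis.
From mathcomp Require Import ess_sup_inf.

Set Implicit Arguments.
Unset Strict Implicit.
Unset Printing Implicit Defensive.

Import Order.TTheory GRing.Theory Num.Theory.
Import numFieldNormedType.Exports.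

Local Open Scope classical_set_scope.
Local Open Scope ring_scope.

(* Points of the plane are column vectors ['cV[R]_2]. The library norm on
   matrices is the sup norm, hence a separate Euclidean norm. *)
Definition enorm (R : realType) (v : 'cV[R]_2) : R :=
  Num.sqrt (v 0 0 ^+ 2 + v 1 0 ^+ 2).

(* The matrix (p, -q; q, p). *)
Definition rotscale (R : realType) (p q : R) : 'M[R]_2 :=
  \matrix_(i, j) (if i == j then p else if (i < j)%N then - q else q).

Definition drift (R : realType) (alpha beta a b : R) (Z : 'cV[R]_2) :
    'cV[R]_2 :=
  rotscale alpha beta *m Z
  - (Z 0 0 ^+ 2 + Z 1 0 ^+ 2) *: (rotscale a b *m Z).

(* C_0(R, R^2); as a [set_type] it carries the topology induced by the
   compact-open topology. *)
Definition path_space (R : realType) : Type :=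
  @set_type {compact-open, R -> 'cV[R]_2}
    [set w | continuous (w : R -> 'cV[R]_2) /\ w 0 = 0].

Definition path0 (R : realType) : path_space R.
Proof.
by exists (fun=> 0); rewrite inE; split => //; exact: cst_continuous.
Defined.

HB.instance Definition _ (R : realType) :=
  Topological.on (path_space R).
HB.instance Definition _ (R : realType) :=
  isPointed.Build (path_space R) (path0 R).

(* Omega with its Borel sigma-algebra. *)
Definition wiener_space (R : realType) :=
  g_sigma_algebraType (@open (path_space R)).

Definition W (R : realType) (t : R) (w : wiener_space R) : 'cV[R]_2 :=
  (\val (w : path_space R) : R -> 'cV[R]_2) t.

(* Since W_0 = 0 on the path space, these conditions fix all the
   finite-dimensional distributions, at positive and negative times, hence P.
   The second argument of [normal_prob] is the standard deviation. The
   independence condition covers the 2n scalar increments jointly; every finite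
   set of times is a prefix of a strictly increasing sequence [tau]. *)
Record two_sided_wiener (R : realType) (P : probability (wiener_space R) R) :
    Prop := TwoSidedWiener {
  wiener_gaussian : forall (s t : R) (k : 'I_2) (A : set R),
    s < t -> measurable A ->
    P [set w | A ((W t w - W s w) k 0)]
      = normal_prob 0 (Num.sqrt (t - s)) A;
  wiener_independent : forall (n : nat) (tau : nat -> R)
      (A : 'I_n -> 'I_2 -> set R),
    {homo tau : i j / (i < j)%N >-> i < j} ->
    (forall i k, measurable (A i k)) ->
    P [set w | forall i k, A i k ((W (tau i.+1) w - W (tau i) w) k 0)]
      = (\big[*%E/1]_(i < n) \big[*%E/1]_(k < 2)
          P [set w | A i k ((W (tau i.+1) w - W (tau i) w) k 0)%R])%E
}.

(* Only times t >= 0 are constrained. Continuity in time makes the solution of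
   the integral equation unique; the integral is taken componentwise. *)
Definition is_solution_flow (R : realType) (alpha beta a b sigma : R)
    (phi : R -> wiener_space R -> 'cV[R]_2 -> 'cV[R]_2) : Prop :=
  forall (w : wiener_space R) (Z : 'cV[R]_2),
    {within `[0, +oo[, continuous (fun t => phi t w Z)} /\
    forall t : R, 0 <= t ->
      phi t w Z =
        Z + \col_k (\int[lebesgue_measure]_(s in `[0, t])
                      drift alpha beta a b (phi s w Z) k 0)
          + sigma *: W t w.

(* The derivative of phi(t, w, .) at z, applied to v. *)
Definition ftle (R : realType)
    (phi : R -> wiener_space R -> 'cV[R]_2 -> 'cV[R]_2)
    (t : R) (w : wiener_space R) (z v : 'cV[R]_2) : R :=
  t^-1 * ln (enorm ('d (phi t w) z v)).

(* Main.v *)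
Require Import Defs.
From mathcomp Require Import all_boot all_order all_algebra.
From mathcomp Require Import all_classical all_reals all_analysis.
From mathcomp Require Import ess_sup_inf measurable_realfun ring lra.
Import Order.TTheory GRing.Theory Num.Theory.
Import numFieldNormedType.Exports.
Local Open Scope classical_set_scope.
Local Open Scope ring_scope.

Set Implicit Arguments.
Unset Strict Implicit.
Unset Printing Implicit Defensive.

(** Write J for the rotation by a right angle.  The derivative of the flow along
a solution [Z] solves [v' = Df(Z) v].  Along a spiral [Z = rho n], where [n] is
a unit vector turning with angular velocity [beta - 2 b rho^2], this equation
becomes explicit: the coordinates [w] of [v] in the moving frame [(n, J n)]
satisfy [w' = (alpha + rho^2 S) w] with one fixed symmetric matrix
[S = (-3a, -b; -b, -a)].  Its eigenvalues [-2a - kap] and [-2a + kap], where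
[kap^2 = a^2 + b^2], have opposite signs because [b > 2a].  So one solution
grows like [exp (alpha t + lam I)] with [lam > 0] and another one decays in the
same way with [lam < 0], where [I] is the integral of [rho^2] over [[0, t]].
For [rho s = r + k s] one has [I >= k^2 t^3 / 12] whatever [r] is, so the
spiral may start at the given point, [t] may be any positive time, and large
[k] gives any growth and any decay ([reference_path], [amplitude]).

The spiral is the solution driven by the continuous path
[(Z s - z - int_0^s f(Z)) / sigma], and Wiener measure charges every tube
around a continuous path that starts at the origin ([wiener_tube]).  It remains
to see that a driving path in a thin tube produces nearly the same derivative
at [z] ([differential_near_reference]).

For this, the cubic damping makes [f] one-sided Lipschitz around bounded sets
([drift_one_sided]), and after subtraction of the driving path all solutions
are differentiable in time, so that Gronwall's inequality compares them
([driven_comparison]).  The increments of the flow in its initial point depend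
linearly on the initial increment up to a quadratic error
([flow_almost_linear]), and a map with this property is differentiable, with
the limits of difference quotients as partial derivatives
([almost_linear_differentiable]).

For the tube, time is cut into [N] equal blocks.  In one block of length [tau]
the increment falls into a prescribed window of width [1 / N] with a
probability of order [exp (- c N)], whereas an oscillation that leaves the tube
has probability of order [exp (- C N)], with [C > c] because the window lies
near zero on the scale of the tube.  So for large [N] a block behaves well with
positive probability, uniformly in the dyadic mesh on which the oscillation is
tested; the blocks are independent, and the mesh is refined by continuity of
measure.  The oscillation is controlled by Ottaviani's inequality
([ottaviani]), which needs the past of the increments to be independent of
their future: this extends from boxes to sigma-algebras by Dynkin's argument
([independent_sigma]). *)

Lemma ord2P (i : 'I_2) : i = 0 \/ i = 1.
Proof. by case: i => -[|[|//]] i; [left|right]; exact: val_inj. Qed.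

Lemma within_continuousM (R : realType) (A : set R) (g x : R -> R) :
  {within A, continuous g} -> {within A, continuous x} ->
  {within A, continuous (fun s => g s * x s)}.
Proof. by move=> cg cx s; apply: cvgM; [exact: cg|exact: cx]. Qed.

Lemma within_continuousB (R : realType) (A : set R) (g h : R -> R) :
  {within A, continuous g} -> {within A, continuous h} ->
  {within A, continuous (fun s => g s - h s)}.
Proof. by move=> cg ch s; apply: cvgB; [exact: cg|exact: ch]. Qed.

Lemma within_continuousD (R : realType) (A : set R) (g h : R -> R) :
  {within A, continuous g} -> {within A, continuous h} ->
  {within A, continuous (fun s => g s + h s)}.
Proof. by move=> cg ch s; apply: cvgD; [exact: cg|exact: ch]. Qed.

Lemma within_continuousZ (R : realType) (A : set R) (c : R) (g : R -> R) :
  {within A, continuous g} -> {within A, continuous (fun s => c * g s)}.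
Proof. by move=> cg s; apply: cvgM; [exact: cvg_cst|exact: cg]. Qed.

(** * The drift and its linearisation in coordinates *)

Section PlanarDrift.
Variables (R : realType) (al be a b : R).

Definition drift_x (x y : R) := al * x - be * y - (x ^+ 2 + y ^+ 2) * (a * x - b * y).
Definition drift_y (x y : R) := be * x + al * y - (x ^+ 2 + y ^+ 2) * (b * x + a * y).

Lemma drift_xE (Z : 'cV[R]_2) : drift al be a b Z 0 0 = drift_x (Z 0 0) (Z 1 0).
Proof.
rewrite /drift /drift_x /rotscale !mxE !big_ord_recl !big_ord0 !mxE/=.
rewrite (_ : lift ord0 ord0 = 1) /=; last exact: val_inj.
ring.
Qed.

Lemma drift_yE (Z : 'cV[R]_2) : drift al be a b Z 1 0 = drift_y (Z 0 0) (Z 1 0).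
Proof.
rewrite /drift /drift_y /rotscale !mxE !big_ord_recl !big_ord0 !mxE/=.
rewrite (_ : lift ord0 ord0 = 1) /=; last exact: val_inj.
ring.
Qed.

(** The linearisation [Df(x, y)] applied to [(u, v)]: first coordinate here,
second in [lin_y]. *)
Definition lin_x (x y u v : R) :=
  al * u - be * v - (x ^+ 2 + y ^+ 2) * (a * u - b * v)
  - 2 * (x * u + y * v) * (a * x - b * y).
Definition lin_y (x y u v : R) :=
  be * u + al * v - (x ^+ 2 + y ^+ 2) * (b * u + a * v)
  - 2 * (x * u + y * v) * (b * x + a * y).

Lemma dot_sqr_le (x y u v : R) :
  (x * u + y * v) ^+ 2 <= (x ^+ 2 + y ^+ 2) * (u ^+ 2 + v ^+ 2).
Proof.
rewrite -subr_ge0.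
have -> : (x ^+ 2 + y ^+ 2) * (u ^+ 2 + v ^+ 2) - (x * u + y * v) ^+ 2
  = (x * v - y * u) ^+ 2 by ring.
exact: sqr_ge0.
Qed.

Lemma dot_rot_sqr_le (x y u v : R) :
  (u * (a * x - b * y) + v * (b * x + a * y)) ^+ 2
  <= (a ^+ 2 + b ^+ 2) * ((x ^+ 2 + y ^+ 2) * (u ^+ 2 + v ^+ 2)).
Proof.
apply: le_trans (dot_sqr_le _ _ _ _) _.
by rewrite le_eqVlt; apply/orP; left; apply/eqP; ring.
Qed.

Let osl_coef_ge0 (A : R) : 0 < a -> 0 <= A -> 0 <= a + 1 + A + A / (2 * a).
Proof.
move=> a0 A0; have := ltW a0 => a0'.
have : 0 <= A / (2 * a) by rewrite divr_ge0// mulr_ge0.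
lra.
Qed.

(** A one-sided Lipschitz constant on the disc of squared radius [M]; the last
term comes from absorbing a cubic term into the quartic damping. *)
Definition osl_cst (M : R) : R :=
  `|al| + (a + 1 + (a ^+ 2 + b ^+ 2) + (a ^+ 2 + b ^+ 2) / (2 * a)) * M.

Lemma osl_cst_ge0 (M : R) : 0 < a -> 0 <= M -> 0 <= osl_cst M.
Proof.
move=> a0 M0; rewrite /osl_cst addr_ge0// mulr_ge0//.
have A0 : 0 <= a ^+ 2 + b ^+ 2 by rewrite addr_ge0 ?sqr_ge0.
exact: osl_coef_ge0.
Qed.

(** Only [(x, y)] is bounded, the increment [(u, v)] is arbitrary: this is where
the damping [a > 0] enters.  With [n = |(u, v)|^2] the terms of the cubic part
that are linear in [n] are controlled by [M], and those of order 3/2 in [n] by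
[a n^2]. *)
Lemma drift_one_sided (M x y u v : R) : 0 < a -> x ^+ 2 + y ^+ 2 <= M ->
  u * (drift_x (x + u) (y + v) - drift_x x y)
  + v * (drift_y (x + u) (y + v) - drift_y x y)
  <= osl_cst M * (u ^+ 2 + v ^+ 2).
Proof.
move=> a0 PM.
set n := u ^+ 2 + v ^+ 2; set P := x ^+ 2 + y ^+ 2 in PM *.
set s := x * u + y * v.
set q := u * (a * x - b * y) + v * (b * x + a * y).
set A := a ^+ 2 + b ^+ 2.
have n0 : 0 <= n by rewrite /n addr_ge0 ?sqr_ge0.
have P0 : 0 <= P by rewrite /P addr_ge0 ?sqr_ge0.
have A0 : 0 <= A by rewrite /A addr_ge0 ?sqr_ge0.
have sn : s ^+ 2 <= P * n by exact: dot_sqr_le.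
have qn : q ^+ 2 <= A * (P * n) by exact: dot_rot_sqr_le.
have -> : u * (drift_x (x + u) (y + v) - drift_x x y)
  + v * (drift_y (x + u) (y + v) - drift_y x y)
  = al * n - a * (P + 2 * s + n) * n - (2 * s + n) * q.
  by rewrite /drift_x /drift_y /n /P /s /q; ring.
(* absorb the mixed terms into the quartic damping [a n^2] *)
have i1 : - (2 * s * q) <= s ^+ 2 + q ^+ 2 by have := sqr_ge0 (s + q); nra.
have i2 : - (2 * a * s * n) <= a * (n ^+ 2 / 2 + 2 * s ^+ 2).
  have := mulr_ge0 (ltW a0) (sqr_ge0 (n + 2 * s)); nra.
have i3 : - (n * q) <= a * n ^+ 2 / 2 + q ^+ 2 / (2 * a).
  have -> : a * n ^+ 2 / 2 + q ^+ 2 / (2 * a) =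
    (a * n + q) ^+ 2 / (2 * a) - n * q by field; rewrite gt_eqF.
  by rewrite -[leLHS]add0r lerD2r divr_ge0 ?sqr_ge0// mulr_ge0// ltW.
have i4 : q ^+ 2 / (2 * a) <= A / (2 * a) * (P * n).
  have -> : A / (2 * a) * (P * n) = A * (P * n) / (2 * a) by ring.
  by rewrite ler_pM2r// invr_gt0 mulr_gt0.
have i5 : al * n <= `|al| * n by rewrite ler_wpM2r// ler_norm.
have c0 : 0 <= a + 1 + A + A / (2 * a) by exact: osl_coef_ge0.
have i6 : (a + 1 + A + A / (2 * a)) * P * n <= (a + 1 + A + A / (2 * a)) * M * n.
  by rewrite ler_wpM2r// ler_wpM2l.
have i7 : a * s ^+ 2 <= a * (P * n) by rewrite ler_wpM2l// ltW.
rewrite /osl_cst -/A.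
move: i4 i6; set B := A / (2 * a); set Q := q ^+ 2 / (2 * a) in i3 * => i4 i6.
nra.
Qed.

(** The infinitesimal version of [drift_one_sided], with the same constant. *)
Lemma linear_one_sided (M x y u v : R) : 0 < a -> x ^+ 2 + y ^+ 2 <= M ->
  u * lin_x x y u v + v * lin_y x y u v <= osl_cst M * (u ^+ 2 + v ^+ 2).
Proof.
move=> a0 PM.
set n := u ^+ 2 + v ^+ 2; set P := x ^+ 2 + y ^+ 2 in PM *.
set s := x * u + y * v.
set q := u * (a * x - b * y) + v * (b * x + a * y).
set A := a ^+ 2 + b ^+ 2.
have n0 : 0 <= n by rewrite /n addr_ge0 ?sqr_ge0.
have P0 : 0 <= P by rewrite /P addr_ge0 ?sqr_ge0.
have A0 : 0 <= A by rewrite /A addr_ge0 ?sqr_ge0.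
have sn : s ^+ 2 <= P * n by exact: dot_sqr_le.
have qn : q ^+ 2 <= A * (P * n) by exact: dot_rot_sqr_le.
have -> : u * lin_x x y u v + v * lin_y x y u v = al * n - a * P * n - 2 * s * q.
  by rewrite /lin_x /lin_y /n /P /s /q; ring.
have i1 : - (2 * s * q) <= s ^+ 2 + q ^+ 2 by have := sqr_ge0 (s + q); nra.
have i5 : al * n <= `|al| * n by rewrite ler_wpM2r// ler_norm.
have c0 : 0 <= a + 1 + A + A / (2 * a) by exact: osl_coef_ge0.
have i6 : (a + 1 + A + A / (2 * a)) * P * n <= (a + 1 + A + A / (2 * a)) * M * n.
  by rewrite ler_wpM2r// ler_wpM2l.
have i8 : 0 <= a * (P * n) by rewrite !mulr_ge0// ltW.
have i9 : 0 <= A / (2 * a) * (P * n).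
  by apply: mulr_ge0; [rewrite divr_ge0// mulr_ge0// ltW | exact: mulr_ge0].
rewrite /osl_cst -/A; move: i6 i9; set B := A / (2 * a) => i6 i9.
nra.
Qed.

Lemma sum3_sqr_le (x y z : R) :
  (x + y + z) ^+ 2 <= 3 * (x ^+ 2 + y ^+ 2 + z ^+ 2).
Proof.
by have := sqr_ge0 (x - y); have := sqr_ge0 (y - z); have := sqr_ge0 (x - z); nra.
Qed.

Definition taylor_cst (M : R) : R := 2 * (a ^+ 2 + b ^+ 2) * (9 * M + 2).

(** The drift is a cubic polynomial, so its remainder of first order is
quadratic in the increment, locally uniformly. *)
Lemma drift_taylor (M x y u v : R) : x ^+ 2 + y ^+ 2 <= M ->
  u ^+ 2 + v ^+ 2 <= 1 ->
  (drift_x (x + u) (y + v) - drift_x x y - lin_x x y u v) ^+ 2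
  + (drift_y (x + u) (y + v) - drift_y x y - lin_y x y u v) ^+ 2
  <= taylor_cst M * (u ^+ 2 + v ^+ 2) ^+ 2.
Proof.
move=> PM n1.
set n := u ^+ 2 + v ^+ 2 in n1 *; set P := x ^+ 2 + y ^+ 2 in PM *.
set s := x * u + y * v.
set A := a ^+ 2 + b ^+ 2.
have n0 : 0 <= n by rewrite /n addr_ge0 ?sqr_ge0.
have P0 : 0 <= P by rewrite /P addr_ge0 ?sqr_ge0.
have A0 : 0 <= A by rewrite /A addr_ge0 ?sqr_ge0.
have sn : s ^+ 2 <= P * n by exact: dot_sqr_le.
(* with d = (u, v) and p = (x, y) the remainder is minus the matrix
   (a, -b; b, a) applied to (2 s + n) d + n p *)
have -> : (drift_x (x + u) (y + v) - drift_x x y - lin_x x y u v) ^+ 2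
  + (drift_y (x + u) (y + v) - drift_y x y - lin_y x y u v) ^+ 2
  = A * (((2 * s + n) * u + n * x) ^+ 2 + ((2 * s + n) * v + n * y) ^+ 2).
  by rewrite /drift_x /drift_y /lin_x /lin_y /n /s /A; ring.
have -> : taylor_cst M * n ^+ 2 = A * (2 * (9 * M + 2) * n ^+ 2).
  by rewrite /taylor_cst /A; ring.
rewrite ler_wpM2l//.
have -> : ((2 * s + n) * u + n * x) ^+ 2 + ((2 * s + n) * v + n * y) ^+ 2
  = (2 * s + n) ^+ 2 * n + 2 * (2 * s + n) * n * s + n ^+ 2 * P.
  by rewrite /n /P /s; ring.
have i1 : 2 * (2 * s + n) * n * s <= n * ((2 * s + n) ^+ 2 + s ^+ 2).
  have := mulr_ge0 n0 (sqr_ge0 (2 * s + n - s)); nra.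
have i2 : (2 * s + n) ^+ 2 <= 8 * s ^+ 2 + 2 * n ^+ 2.
  have := sqr_ge0 (2 * s - n); nra.
have i2' := ler_wpM2l n0 i2.
have i3 := ler_wpM2l n0 sn.
have i4 : n ^+ 2 * P <= n ^+ 2 * M by rewrite ler_wpM2l// sqr_ge0.
have i5 : n ^+ 2 * n <= n ^+ 2 by rewrite ler_piMr// sqr_ge0.
nra.
Qed.

Let shift_bounds (M x y u v : R) : x ^+ 2 + y ^+ 2 <= M ->
  u ^+ 2 + v ^+ 2 <= 1 ->
  (2 * (x * u + y * v) + (u ^+ 2 + v ^+ 2)) ^+ 2
    <= (8 * M + 2) * (u ^+ 2 + v ^+ 2) /\
  (x + u) ^+ 2 + (y + v) ^+ 2 <= 2 * M + 2.
Proof.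
move=> PM n1.
have sn := dot_sqr_le x y u v.
set n := u ^+ 2 + v ^+ 2 in n1 sn *; set P := x ^+ 2 + y ^+ 2 in PM sn *.
set s := x * u + y * v in sn *.
have n0 : 0 <= n by rewrite /n addr_ge0 ?sqr_ge0.
split.
  have i2 : (2 * s + n) ^+ 2 <= 8 * s ^+ 2 + 2 * n ^+ 2.
    have := sqr_ge0 (2 * s - n); nra.
  have i4 : P * n <= M * n by rewrite ler_wpM2r.
  have i5 : n * n <= n by rewrite ler_piMr.
  nra.
rewrite /P /n in PM n1.
have := sqr_ge0 (x - u); have := sqr_ge0 (y - v); nra.
Qed.

Definition lip_cst (M : R) : R :=
  3 * (al ^+ 2 + be ^+ 2 + (2 * M + 2) ^+ 2 * (a ^+ 2 + b ^+ 2)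
       + (8 * M + 2) * (a ^+ 2 + b ^+ 2) * M).

Lemma drift_local_lipschitz (M x y u v : R) : x ^+ 2 + y ^+ 2 <= M ->
  u ^+ 2 + v ^+ 2 <= 1 ->
  (drift_x (x + u) (y + v) - drift_x x y) ^+ 2
  + (drift_y (x + u) (y + v) - drift_y x y) ^+ 2
  <= lip_cst M * (u ^+ 2 + v ^+ 2).
Proof.
move=> PM n1; have [i1 i2] := shift_bounds PM n1.
have P0 : 0 <= x ^+ 2 + y ^+ 2 by rewrite addr_ge0 ?sqr_ge0.
have A0 : 0 <= a ^+ 2 + b ^+ 2 by rewrite addr_ge0 ?sqr_ge0.
set n := u ^+ 2 + v ^+ 2 in n1 i1 i2 *.
set t := 2 * (x * u + y * v) + n in i1.
set m := (x + u) ^+ 2 + (y + v) ^+ 2 in i2.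
set P := x ^+ 2 + y ^+ 2 in PM P0.
have n0 : 0 <= n by rewrite /n addr_ge0 ?sqr_ge0.
have m0 : 0 <= m by rewrite /m addr_ge0 ?sqr_ge0.
have -> : drift_x (x + u) (y + v) - drift_x x y = (al * u - be * v)
   + (- (m * (a * u - b * v))) + (- (t * (a * x - b * y))).
  by rewrite /drift_x /m /t /n; ring.
have -> : drift_y (x + u) (y + v) - drift_y x y = (be * u + al * v)
   + (- (m * (b * u + a * v))) + (- (t * (b * x + a * y))).
  by rewrite /drift_y /m /t /n; ring.
apply: le_trans (lerD (sum3_sqr_le _ _ _) (sum3_sqr_le _ _ _)) _.
rewrite -mulrDr /lip_cst -[leRHS]mulrA ler_wpM2l//.
have -> : (al * u - be * v) ^+ 2 + (- (m * (a * u - b * v))) ^+ 2 +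
  (- (t * (a * x - b * y))) ^+ 2 + ((be * u + al * v) ^+ 2 +
  (- (m * (b * u + a * v))) ^+ 2 + (- (t * (b * x + a * y))) ^+ 2)
  = (al ^+ 2 + be ^+ 2) * n + m ^+ 2 * (a ^+ 2 + b ^+ 2) * n
    + t ^+ 2 * (a ^+ 2 + b ^+ 2) * P.
  by rewrite /n /P; ring.
rewrite [leRHS]mulrDl; apply: lerD.
  rewrite [leRHS]mulrDl; apply: lerD => //.
  rewrite !ler_wpM2r// ler_pXn2r// nnegrE//.
  exact: le_trans i2.
have -> : (8 * M + 2) * (a ^+ 2 + b ^+ 2) * M * n
  = (8 * M + 2) * n * (a ^+ 2 + b ^+ 2) * M by ring.
apply: ler_pM => //.
  by rewrite mulr_ge0// sqr_ge0.
by rewrite ler_wpM2r.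
Qed.

Definition lin_lip_cst (M : R) : R := 3 * (a ^+ 2 + b ^+ 2) * (20 * M + 10).

Lemma linearization_lipschitz (M x y u v p q : R) : x ^+ 2 + y ^+ 2 <= M ->
  u ^+ 2 + v ^+ 2 <= 1 ->
  (lin_x (x + u) (y + v) p q - lin_x x y p q) ^+ 2
  + (lin_y (x + u) (y + v) p q - lin_y x y p q) ^+ 2
  <= lin_lip_cst M * ((u ^+ 2 + v ^+ 2) * (p ^+ 2 + q ^+ 2)).
Proof.
move=> PM n1; have [i1 i2] := shift_bounds PM n1.
have P0 : 0 <= x ^+ 2 + y ^+ 2 by rewrite addr_ge0 ?sqr_ge0.
have A0 : 0 <= a ^+ 2 + b ^+ 2 by rewrite addr_ge0 ?sqr_ge0.
have i3 := dot_sqr_le (x + u) (y + v) p q.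
have i4 := dot_sqr_le u v p q.
set n := u ^+ 2 + v ^+ 2 in n1 i1 i2 i4 *.
set U := p ^+ 2 + q ^+ 2 in i3 i4 *.
set t := 2 * (x * u + y * v) + n in i1.
set m := (x + u) ^+ 2 + (y + v) ^+ 2 in i2 i3.
set P := x ^+ 2 + y ^+ 2 in PM P0.
set c := (x + u) * p + (y + v) * q in i3.
set d := u * p + v * q in i4.
have n0 : 0 <= n by rewrite /n addr_ge0 ?sqr_ge0.
have U0 : 0 <= U by rewrite /U addr_ge0 ?sqr_ge0.
have -> : lin_x (x + u) (y + v) p q - lin_x x y p q =
   - (t * (a * p - b * q)) + (- (2 * c * (a * u - b * v)))
   + (- (2 * d * (a * x - b * y))).
  by rewrite /lin_x /c /d /t /n; ring.
have -> : lin_y (x + u) (y + v) p q - lin_y x y p q =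
   - (t * (b * p + a * q)) + (- (2 * c * (b * u + a * v)))
   + (- (2 * d * (b * x + a * y))).
  by rewrite /lin_y /c /d /t /n; ring.
apply: le_trans (lerD (sum3_sqr_le _ _ _) (sum3_sqr_le _ _ _)) _.
have -> : lin_lip_cst M * (n * U) =
  3 * ((a ^+ 2 + b ^+ 2) * ((20 * M + 10) * (n * U))).
  by rewrite /lin_lip_cst; ring.
rewrite -mulrDr ler_wpM2l//.
rewrite [leLHS](_ : _ = (a ^+ 2 + b ^+ 2) *
  (t ^+ 2 * U + 4 * c ^+ 2 * n + 4 * d ^+ 2 * P)); last first.
  by rewrite /n /P /U; ring.
rewrite ler_wpM2l//.
have j1 : t ^+ 2 * U <= (8 * M + 2) * n * U by rewrite ler_wpM2r.
have j2 : c ^+ 2 * n <= (2 * M + 2) * U * n.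
  by rewrite ler_wpM2r// (le_trans i3)// ler_wpM2r.
have j3 : d ^+ 2 * P <= n * U * M by apply: ler_pM => //; exact: sqr_ge0.
lra.
Qed.

End PlanarDrift.

(** * Gronwall's inequality *)

Section Gronwall.
Variable R : realType.
Implicit Types (T K c s : R) (g x y : R -> R).

(** [exp (- K s) g s - c s] is nonincreasing.  Differentiability is required in
the open interval only, since solutions are differentiable only there. *)
Lemma gronwall T K c g g' : 0 <= K -> 0 <= c ->
  {within `[0, T], continuous g} ->
  (forall s, s \in `]0, T[ -> is_derive s 1 g (g' s)) ->
  (forall s, s \in `]0, T[ -> g' s <= K * g s + c) ->
  forall s, s \in `[0, T] -> g s <= (g 0 + c * s) * expR (K * s).
Proof.
move=> K0 c0 cg dg hg s s0T.
pose G := fun s : R => expR (- K * s) * g s - c * s.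
have dG r : r \in `]0, T[ -> is_derive r 1 G
    (expR (- K * r) * g' r + g r * (expR (- K * r) * - K) - c).
  move=> r0T; have dgr := dg r r0T.
  have dE : is_derive r 1 (fun s => expR (- K * s)) (expR (- K * r) * - K).
    have dl : is_derive r 1 (fun s => - K * s) (- K).
      by apply: is_derive_eq; rewrite /GRing.scale /= mulr1.
    have := is_derive1_comp (f := expR) (g := fun s => - K * s) (x := r).
    by move=> /(_ _ _ _ dl); apply.
  have dc : is_derive r 1 (fun s => c * s) c.
    by apply: is_derive_eq; rewrite /GRing.scale /= mulr1.
  by apply: is_derive_eq.
have G_noninc : G s <= G 0.
  move: s0T; rewrite in_itv/= => /andP[s0 sT].
  apply: (@ler0_derive1_le_cc _ G 0 T).
  - by move=> r /dG [].
  - move=> r r0T; have [? e] := dG r r0T; rewrite derive1E e.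
    have E1 : expR (- K * r) <= 1.
      rewrite -[leRHS]expR0 ler_expR mulNr oppr_le0 mulr_ge0//.
      by move: r0T; rewrite in_itv/= => /andP[/ltW].
    have E0 := expR_ge0 (- K * r).
    have h := ler_wpM2l E0 (hg r r0T).
    have := ler_wpM2r c0 E1; lra.
  - have cE : {within `[0, T], continuous (fun s => expR (- K * s))}.
      apply: continuous_subspaceT => r.
      apply: continuous_comp; last exact: continuous_expR.
      by apply: continuousM => //; exact: cst_continuous.
    have cc : {within `[0, T], continuous (fun s => c * s)}.
      apply: continuous_subspaceT => r.
      by apply: continuousM => //; exact: cst_continuous.
    move=> r; apply: cvgB; last exact: cc.
    exact: (within_continuousM cE cg).
  - by rewrite in_itv/= s0.
  - by rewrite in_itv/= lexx (le_trans s0 sT).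
  - exact: s0.
have e1 : expR (- K * s) * expR (K * s) = 1.
  by rewrite -expRD mulNr addNr expR0.
have : expR (- K * s) * g s <= g 0 + c * s.
  by move: G_noninc; rewrite /G mulr0 expR0 mul1r mulr0 subr0 lerBlDr.
move=> /(ler_wpM2r (expR_ge0 (K * s))); rewrite mulrAC e1 mul1r.
by apply.
Qed.

Lemma planar_gronwall T K c x y x' y' : 0 <= K -> 0 <= c ->
  {within `[0, T], continuous x} -> {within `[0, T], continuous y} ->
  (forall s, s \in `]0, T[ -> is_derive s 1 x (x' s)) ->
  (forall s, s \in `]0, T[ -> is_derive s 1 y (y' s)) ->
  (forall s, s \in `]0, T[ ->
    2 * (x s * x' s + y s * y' s) <= K * (x s ^+ 2 + y s ^+ 2) + c) ->
  forall s, s \in `[0, T] ->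
    x s ^+ 2 + y s ^+ 2 <= (x 0 ^+ 2 + y 0 ^+ 2 + c * s) * expR (K * s).
Proof.
move=> K0 c0 cx cy dx dy h s sT.
apply: (@gronwall T K c (fun s => x s ^+ 2 + y s ^+ 2)
  (fun s => 2 * (x s * x' s + y s * y' s))) => //.
- by move=> r; apply: cvgD; apply: within_continuousM.
- move=> r r0T; have ? := dx _ r0T; have ? := dy _ r0T.
  apply: is_derive_eq; rewrite /GRing.scale/=; ring.
Qed.

End Gronwall.

(** * Solutions driven by a continuous path *)

Section DrivenSolutions.
Variables (R : realType) (al be a b T : R).
Hypothesis (a0 : 0 < a).
Implicit Types (x y p q : R -> R) (s M : R).

Local Notation f0 := (drift_x al be a b).
Local Notation f1 := (drift_y al be a b).
Local Notation L0 := (lin_x al be a b).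
Local Notation L1 := (lin_y al be a b).
Local Notation osl := (osl_cst al a b).

(** An additive forcing [(n0, n1)] need not be differentiable, so the equation is
stated for the difference of the solution and the forcing. *)
Record driven_solution (n0 n1 x y : R -> R) : Prop := DrivenSolution {
  driven_cn0 : {within `[0, T], continuous n0};
  driven_cn1 : {within `[0, T], continuous n1};
  driven_cx : {within `[0, T], continuous x};
  driven_cy : {within `[0, T], continuous y};
  driven_dx : forall s, s \in `]0, T[ ->
    is_derive s 1 (fun s => x s - n0 s) (f0 (x s) (y s));
  driven_dy : forall s, s \in `]0, T[ ->
    is_derive s 1 (fun s => y s - n1 s) (f1 (x s) (y s)) }.

(** The factor [2] and the summand [2] come from passing between a solution and
its difference with the forcing; [2 M + 2] bounds the squared norm of a point
of the disc of squared radius [M] moved by at most one. *)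
Definition cmp_cst M : R :=
  2 * (1 + lip_cst al be a b M * T) * expR ((2 * osl (2 * M + 2) + 1) * T) + 2.

Lemma lip_cst_ge0 M : 0 <= M -> 0 <= lip_cst al be a b M.
Proof.
move=> M0; rewrite /lip_cst mulr_ge0// !addr_ge0// ?sqr_ge0// !mulr_ge0//;
by rewrite ?sqr_ge0// addr_ge0// ?sqr_ge0// mulr_ge0.
Qed.

(** The forcings differ by a nondifferentiable path, so the curve to estimate is
the difference of the parts that remain after removing the forcing.  Its
derivative compares the drift at points shifted by the difference of the
forcings, and [drift_one_sided] at the shifted point applies without any bound
on the second solution. *)
Lemma driven_comparison M e n0 n1 m0 m1 x y p q :
  0 <= e <= 1 ->
  driven_solution n0 n1 x y -> driven_solution m0 m1 p q ->
  n0 0 = m0 0 -> n1 0 = m1 0 ->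
  (forall s, s \in `[0, T] -> x s ^+ 2 + y s ^+ 2 <= M) ->
  (forall s, s \in `[0, T] -> (m0 s - n0 s) ^+ 2 + (m1 s - n1 s) ^+ 2 <= e) ->
  forall s, s \in `[0, T] ->
  (p s - x s) ^+ 2 + (q s - y s) ^+ 2
  <= cmp_cst M * ((p 0 - x 0) ^+ 2 + (q 0 - y 0) ^+ 2 + e).
Proof.
move=> /andP[e0 e1] xy pq h0 h1 hM he s sT.
have T0 : 0 <= T by move: sT; rewrite in_itv/= => /andP[/le_trans]; apply.
have M0 : 0 <= M.
  by apply: le_trans (hM 0 _); rewrite ?addr_ge0 ?sqr_ge0// in_itv/= lexx.
(* the difference of the noise-free parts is differentiable *)
pose u r := (p r - m0 r) - (x r - n0 r).
pose v r := (q r - m1 r) - (y r - n1 r).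
set K := osl (2 * M + 2); set C := lip_cst al be a b M.
have K0 : 0 <= K by rewrite osl_cst_ge0// addr_ge0// mulr_ge0.
have C0 : 0 <= C by exact: lip_cst_ge0.
have sub r : r \in `]0, T[ -> r \in `[0, T].
  by rewrite !in_itv/= => /andP[/ltW-> /ltW->].
have main : u s ^+ 2 + v s ^+ 2 <=
  (u 0 ^+ 2 + v 0 ^+ 2 + C * e * s) * expR ((2 * K + 1) * s).
  apply: (@planar_gronwall R T (2 * K + 1) (C * e) u v
    (fun r => f0 (p r) (q r) - f0 (x r) (y r))
    (fun r => f1 (p r) (q r) - f1 (x r) (y r))) => //.
  - by rewrite addr_ge0// mulr_ge0.
  - exact: mulr_ge0.
  - apply: within_continuousB.
      exact: within_continuousB (driven_cx pq) (driven_cn0 pq).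
    exact: within_continuousB (driven_cx xy) (driven_cn0 xy).
  - apply: within_continuousB.
      exact: within_continuousB (driven_cy pq) (driven_cn1 pq).
    exact: within_continuousB (driven_cy xy) (driven_cn1 xy).
  - move=> r rT; have := driven_dx pq rT; have := driven_dx xy rT.
    by move=> ? ?; apply: is_deriveB.
  - move=> r rT; have := driven_dy pq rT; have := driven_dy xy rT.
    by move=> ? ?; apply: is_deriveB.
  move=> r /sub rT.
  have hMr := hM _ rT; have her := he _ rT.
  set i := m0 r - n0 r in her *; set j := m1 r - n1 r in her *.
  have e1' : i ^+ 2 + j ^+ 2 <= 1 by exact: le_trans e1.
  have Mr : (x r + i) ^+ 2 + (y r + j) ^+ 2 <= 2 * M + 2.
    have := sqr_ge0 (x r - i); have := sqr_ge0 (y r - j); nra.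
  have A := drift_one_sided al be b (u r) (v r) a0 Mr.
  have B := drift_local_lipschitz al be a b hMr e1'.
  have pE : p r = x r + i + u r by rewrite /u /i; ring.
  have qE : q r = y r + j + v r by rewrite /v /j; ring.
  rewrite -pE -qE -/K in A; rewrite -/C in B.
  have B' : C * (i ^+ 2 + j ^+ 2) <= C * e by rewrite ler_wpM2l.
  move: A B; set F := f0 (x r + i) _; set G := f1 (x r + i) _ => A B.
  have := sqr_ge0 (u r - (F - f0 (x r) (y r))).
  have := sqr_ge0 (v r - (G - f1 (x r) (y r))).
  nra.
have sE : s <= T by move: sT; rewrite in_itv/= => /andP[].
have s0 : 0 <= s by move: sT; rewrite in_itv/= => /andP[].
have u0E : u 0 = p 0 - x 0 by rewrite /u h0; ring.
have v0E : v 0 = q 0 - y 0 by rewrite /v h1; ring.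
rewrite u0E v0E in main.
set d0 := (p 0 - x 0) ^+ 2 + (q 0 - y 0) ^+ 2 in main *.
have d00 : 0 <= d0 by rewrite addr_ge0 ?sqr_ge0.
have E1 : expR ((2 * K + 1) * s) <= expR ((2 * K + 1) * T).
  by rewrite ler_expR ler_wpM2l// addr_ge0// mulr_ge0.
have her := he _ sT.
have triangle : (p s - x s) ^+ 2 + (q s - y s) ^+ 2 <=
    2 * (u s ^+ 2 + v s ^+ 2) + 2 * e.
  rewrite /u /v; set i := m0 s - n0 s in her; set j := m1 s - n1 s in her.
  have := sqr_ge0 (p s - m0 s - (x s - n0 s) - i).
  have := sqr_ge0 (q s - m1 s - (y s - n1 s) - j).
  rewrite /i /j in her *; nra.
have E0 := expR_ge0 ((2 * K + 1) * T).
have main2 : u s ^+ 2 + v s ^+ 2 <=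
    (1 + C * T) * (d0 + e) * expR ((2 * K + 1) * T).
  apply: le_trans main _.
  have CT : 0 <= C * T by exact: mulr_ge0.
  have CTd := mulr_ge0 CT d00.
  have Cs : C * e * s <= C * e * T by rewrite ler_wpM2l// mulr_ge0.
  apply: ler_pM => //.
    apply: addr_ge0 => //; apply: mulr_ge0 => //; exact: mulr_ge0.
  nra.
rewrite /cmp_cst -/C -/K.
move: main2 E0; set E := expR _ => main2 E0.
have := mulr_ge0 (mulr_ge0 (ler0n R 2) d00) E0.
nra.
Qed.

(** The [+ 1] in the exponent pays for the product of the solution with the
inhomogeneous term [(r0, r1)]. *)
Lemma linear_comparison M c x y p q r0 r1 : 0 <= c ->
  (forall s, s \in `[0, T] -> p s ^+ 2 + q s ^+ 2 <= M) ->
  {within `[0, T], continuous x} -> {within `[0, T], continuous y} ->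
  (forall s, s \in `]0, T[ ->
    is_derive s 1 x (L0 (p s) (q s) (x s) (y s) + r0 s)) ->
  (forall s, s \in `]0, T[ ->
    is_derive s 1 y (L1 (p s) (q s) (x s) (y s) + r1 s)) ->
  (forall s, s \in `]0, T[ -> r0 s ^+ 2 + r1 s ^+ 2 <= c) ->
  forall s, s \in `[0, T] ->
  x s ^+ 2 + y s ^+ 2
  <= (x 0 ^+ 2 + y 0 ^+ 2 + c * T) * expR ((2 * osl M + 1) * T).
Proof.
move=> c0 hM cx cy dx dy hr s sT.
have /andP[s0 sE] : 0 <= s <= T by move: sT; rewrite in_itv.
have T0 : 0 <= T by exact: le_trans sE.
have M0 : 0 <= M.
  by apply: le_trans (hM 0 _); rewrite ?addr_ge0 ?sqr_ge0// in_itv/= lexx.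
have K0 : 0 <= osl M by rewrite osl_cst_ge0.
have K1 : 0 <= 2 * osl M + 1 by rewrite addr_ge0// mulr_ge0.
have := planar_gronwall K1 c0 cx cy dx dy.
move=> /(_ _ s sT) main.
apply: le_trans (main _) _; last first.
  apply: ler_pM; rewrite ?expR_ge0//.
  - by rewrite !addr_ge0 ?sqr_ge0// mulr_ge0.
  - by rewrite lerD2l ler_wpM2l.
  - by rewrite ler_expR ler_wpM2l.
move=> r rT.
have rT' : r \in `[0, T].
  by move: rT; rewrite !in_itv/= => /andP[/ltW-> /ltW->].
have A := linear_one_sided al be b (x r) (y r) a0 (hM _ rT').
have B := hr _ rT.
have := sqr_ge0 (x r - r0 r); have := sqr_ge0 (y r - r1 r).
nra.
Qed.

End DrivenSolutions.

(** * Differentiability of almost linear maps *)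

Section AlmostLinear.
Variable R : realType.
Local Notation V := ('cV[R]_2).

(** The squared Euclidean norm; the norm [`|v|] of a matrix is the sup norm. *)
Definition sqn (v : V) : R := v 0 0 ^+ 2 + v 1 0 ^+ 2.

Lemma sqn_ge0 v : 0 <= sqn v.
Proof. by rewrite addr_ge0 ?sqr_ge0. Qed.

Lemma sqnZ c v : sqn (c *: v) = c ^+ 2 * sqn v.
Proof. by rewrite /sqn !mxE; ring. Qed.

Lemma normr_le_sqn (v : V) (e : R) : 0 <= e -> sqn v <= e ^+ 2 -> `|v| <= e.
Proof.
move=> e0 h; rewrite [leLHS]/Num.Def.normr/= mx_normrE.
apply/bigmax_leP; split => // -[i j] _ /=.
rewrite (ord1 j) -ler_sqr ?nnegrE// real_normK ?num_real//.
apply: le_trans h; rewrite /sqn.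
by case: (ord2P i) => ->; rewrite ?lerDl ?lerDr ?sqr_ge0.
Qed.

Lemma sqn_le_normr (v : V) : sqn v <= 2 * `|v| ^+ 2.
Proof.
have h (i : 'I_2) : v i 0 ^+ 2 <= `|v| ^+ 2.
  rewrite -real_normK ?num_real// ler_sqr ?nnegrE//.
  rewrite [leRHS]/Num.Def.normr/= mx_normrE.
  exact: (le_bigmax _ (fun ij : 'I_2 * 'I_1 => `|v ij.1 ij.2|) (i, 0)).
have := h 0; have := h 1; rewrite /sqn; lra.
Qed.

Lemma cauchy_sqr_cvg (u e : R^nat) : e @ \oo --> (0 : R) ->
  (forall n m, (u n - u m) ^+ 2 <= e n + e m) -> cvg (u @ \oo).
Proof.
move=> e0 ue; apply/cauchy_cvgP/cauchy_exP => eps eps0.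
have /cvgrPdist_lt/(_ (eps ^+ 2 / 2)) := e0.
rewrite divr_gt0 ?exprn_gt0// => /(_ isT)[N _ hN].
exists (u N); exists N => // n Nn /=.
change (`|u N - u n| < eps).
have hh k : (N <= k)%N -> e k < eps ^+ 2 / 2.
  move=> Nk; have := hN _ Nk; rewrite /= sub0r normrN.
  exact/le_lt_trans/ler_norm.
have := ue N n; have := hh N (leqnn _); have := hh n Nn.
by rewrite ltr_norml => *; apply/andP; split; nra.
Qed.

Lemma invS_cvg0 (c : R) : (fun n => c / n.+1%:R ^+ 2) @ \oo --> (0 : R).
Proof.
rewrite -[X in _ --> X](mulr0 c); apply: cvgM; first exact: cvg_cst.
rewrite -[X in _ --> X](mulr0 (0 : R)).
under eq_fun do rewrite expr2 invfM.
by apply: cvgM; exact: cvg_harmonic.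
Qed.

(** Applied to two multiples of a basis vector, with coefficients cancelling the
linear part, the hypothesis says that the difference quotients are Cauchy.
Applied to a vector and to small multiples of both basis vectors, it says that
the limits of these quotients are the columns of a derivative.  So three
vectors are enough. *)
Lemma almost_linear_differentiable (F : V -> V) (z : V) (H r : R) :
  0 < r <= 1 -> 0 <= H ->
  (forall (c1 c2 c3 : R) (v1 v2 v3 : V),
    sqn v1 <= r -> sqn v2 <= r -> sqn v3 <= r ->
    sqn (c1 *: (F (v1 + z) - F z) + c2 *: (F (v2 + z) - F z)
         + c3 *: (F (v3 + z) - F z))
    <= H * (sqn (c1 *: v1 + c2 *: v2 + c3 *: v3)
       + (c1 ^+ 2 * sqn v1 ^+ 2 + c2 ^+ 2 * sqn v2 ^+ 2
       + c3 ^+ 2 * sqn v3 ^+ 2))) ->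
  forall v, sqn v <= r ->
    sqn (F (v + z) - F z - 'd F z v) <= H * sqn v ^+ 2.
Proof.
move=> /andP[r0 r1] H0 hF.
(* step sizes that keep all multiples of basis vectors in the ball *)
pose h n : R := r / n.+1%:R.
have hn0 n : 0 < h n by rewrite divr_gt0.
have hn1 n : h n <= r by rewrite ler_pdivrMr// ler_peMr// ?ler1n// ltW.
pose e (k : 'I_2) : V := delta_mx k 0.
have sqn_e k : sqn (e k) = 1.
  rewrite /sqn !mxE; case: (ord2P k) => -> /=; ring.
have sqn_he k n : sqn (h n *: e k) <= r.
  rewrite sqnZ sqn_e mulr1; have := hn0 n; have := hn1 n; nra.
pose q k n : V := (h n)^-1 *: (F (h n *: e k + z) - F z).
have hinv n : (h n)^-1 ^+ 2 * (h n ^+ 2) ^+ 2 = h n ^+ 2.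
  by field; rewrite gt_eqF.
have q_cauchy k n m : sqn (q k n - q k m) <= H * h n ^+ 2 + H * h m ^+ 2.
  have := hF (h n)^-1 (- (h m)^-1) 0 (h n *: e k) (h m *: e k) 0
    (sqn_he _ _) (sqn_he _ _).
  have -> : sqn (0 : V) = 0 by rewrite /sqn !mxE; ring.
  move=> /(_ (ltW r0)).
  rewrite !scale0r !addr0 !scalerA mulVf ?gt_eqF// mulNr mulVf ?gt_eqF//.
  rewrite scaleN1r scale1r.
  rewrite /q scaleNr => /le_trans; apply.
  have -> : sqn (e k - e k) = 0 by rewrite subrr /sqn !mxE; ring.
  rewrite !sqnZ sqn_e !mulr1 sqrrN !hinv; lra.
have hsq n : H * h n ^+ 2 = H * r ^+ 2 / n.+1%:R ^+ 2.
  by rewrite /h; field.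
have q_cvg k i : cvg ((fun n => q k n i 0) @ \oo).
  apply: (@cauchy_sqr_cvg _ (fun n => H * h n ^+ 2)).
    by under eq_fun do rewrite hsq; exact: invS_cvg0.
  move=> n m; apply: le_trans (q_cauchy k n m).
  have -> : (q k n i 0 - q k m i 0) ^+ 2 = (q k n - q k m) i 0 ^+ 2.
    by rewrite !mxE.
  by rewrite /sqn; case: (ord2P i) => ->; rewrite ?lerDl ?lerDr ?sqr_ge0.
(* the columns of the derivative *)
pose A : 'M[R]_2 := \matrix_(i, k) lim ((fun n => q k n i 0) @ \oo).
have v_dec (v : V) : v = v 0 0 *: e 0 + v 1 0 *: e 1.
  apply/matrixP => i j; rewrite (ord1 j) !mxE.
  by case: (ord2P i) => ->; rewrite /= ?mulr1 ?mulr0 ?addr0 ?add0r.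
have key v : sqn v <= r -> sqn (F (v + z) - F z - A *m v) <= H * sqn v ^+ 2.
  move=> vr.
  pose g n := F (v + z) - F z - v 0 0 *: q 0 n - v 1 0 *: q 1 n.
  have g_le n : sqn (g n) <= H * sqn v ^+ 2 + H * sqn v * h n ^+ 2.
    have := hF 1 (- (v 0 0 / h n)) (- (v 1 0 / h n)) v (h n *: e 0)
      (h n *: e 1) vr (sqn_he _ _) (sqn_he _ _).
    rewrite scale1r !scaleNr !scalerA !divfK ?gt_eqF// scale1r.
    rewrite [X in v - X - _](_ : _ = v 0 0 *: e 0)//.
    have -> : sqn (v - v 0 0 *: e 0 - v 1 0 *: e 1) = 0.
      by rewrite -addrA -opprD -v_dec subrr /sqn !mxE; ring.
    rewrite /g /q !scalerA => /le_trans; apply.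
    rewrite add0r expr1n mul1r !sqrrN !sqnZ !sqn_e !mulr1 -mulrA -mulrDr.
    have e2 c : (c / h n) ^+ 2 * (h n ^+ 2) ^+ 2 = c ^+ 2 * h n ^+ 2.
      by field; rewrite gt_eqF.
    by rewrite ler_wpM2l// !e2 -addrA lerD2l -mulrDl.
  have g_cvg i : (fun n => g n i 0) @ \oo -->
      (F (v + z) - F z - A *m v) i 0.
    have -> : (F (v + z) - F z - A *m v) i 0 =
      (F (v + z) - F z) i 0 - v 0 0 * A i 0 - v 1 0 * A i 1.
      by rewrite !mxE big_ord_recl big_ord1 !mxE
        (_ : lift ord0 ord0 = 1); [ring | exact: val_inj].
    rewrite /A !mxE.
    have -> : (fun n => g n i 0) = (fun n => F (v + z) i 0 - F z i 0 -
      v 0 0 * q 0 n i 0 - v 1 0 * q 1 n i 0).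
      by apply/funext => n; rewrite /g !mxE.
    apply: cvgB; first (apply: cvgB; first exact: cvg_cst).
      by apply: cvgM; [exact: cvg_cst|exact: q_cvg].
    by apply: cvgM; [exact: cvg_cst|exact: q_cvg].
  have lhs : (fun n => sqn (g n)) @ \oo --> sqn (F (v + z) - F z - A *m v).
    by apply: cvgD; apply: cvgM; exact: g_cvg.
  have rhs : (fun n => H * sqn v ^+ 2 + H * sqn v * h n ^+ 2) @ \oo -->
      H * sqn v ^+ 2.
    rewrite -[X in _ --> X]addr0; apply: cvgD; first exact: cvg_cst.
    rewrite (_ : (fun n => _) =
      (fun n => H * sqn v * r ^+ 2 / n.+1%:R ^+ 2)).
      exact: invS_cvg0.
    by apply/funext => n; rewrite /h; field.
  by apply: ler_cvg_to lhs rhs _; apply: nearW.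
have A_cont : continuous (mulmx A : V -> V).
  apply/linear_bounded_continuous/linear_boundedP.
  pose B := (A 0 0 ^+ 2 + A 0 1 ^+ 2) + (A 1 0 ^+ 2 + A 1 1 ^+ 2).
  have B0 : 0 <= B by rewrite !addr_ge0 ?sqr_ge0.
  exists (2 * B + 1); split; first exact: num_real.
  move=> c cB v; apply: normr_le_sqn.
    by rewrite mulr_ge0// (le_trans _ (ltW cB))// addr_ge0// mulr_ge0.
  have : sqn (A *m v) <= B * sqn v.
    have AvE i : (A *m v) i 0 = A i 0 * v 0 0 + A i 1 * v 1 0.
      by rewrite mxE big_ord_recl big_ord1 (_ : lift ord0 ord0 = 1)//;
        exact: val_inj.
    have h0 := dot_sqr_le (A 0 0) (A 0 1) (v 0 0) (v 1 0).
    have h1 := dot_sqr_le (A 1 0) (A 1 1) (v 0 0) (v 1 0).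
    by rewrite /sqn !AvE /B [leRHS]mulrDl lerD.
  move=> /le_trans; apply.
  apply: le_trans (ler_wpM2l B0 (sqn_le_normr v)) _.
  rewrite exprMn mulrA ler_wpM2r ?sqr_ge0//; nra.
have -> : 'd F z = mulmx A :> (V -> V).
  apply: (@diff_unique R V V F (mulmx A) z) => //.
  apply/eqaddoP => eps eps0.
  pose d := Num.min (r / 2) (eps ^+ 2 / (4 * H + 1)).
  have H1 : 0 < 4 * H + 1 by rewrite ltr_wpDl// mulr_ge0.
  have d0 : 0 < d by rewrite lt_min !divr_gt0// exprn_gt0.
  have dr : d <= r / 2 by rewrite /d ge_min lexx.
  have de : d * (4 * H + 1) <= eps ^+ 2.
    by rewrite -ler_pdivlMr// /d ge_min lexx orbT.
  near=> v.
  have vd : `|v| <= d.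
    by near: v; exact: (@nbhs0_le _ V d d0).
  have v0 : 0 <= `|v| by [].
  have vv : `|v| ^+ 2 <= d by nra.
  have rest : sqn (F (v + z) - F z - A *m v) <= H * sqn v ^+ 2.
    apply: key; apply: le_trans (sqn_le_normr v) _; lra.
  rewrite /= /cst.
  have -> : (F \o shift z - (cst (F z) + mulmx A)) v = F (v + z) - F z - A *m v.
    by rewrite opprD addrA.
  apply: normr_le_sqn; first by rewrite mulr_ge0// ltW.
  apply: le_trans rest _.
  have : sqn v ^+ 2 <= 4 * `|v| ^+ 2 * `|v| ^+ 2.
    have := sqn_le_normr v; have := sqn_ge0 v; nra.
  move=> /(ler_wpM2l H0) /le_trans; apply.
  rewrite exprMn.
  have -> : H * (4 * `|v| ^+ 2 * `|v| ^+ 2) = (4 * (H * `|v| ^+ 2)) * `|v| ^+ 2.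
    by ring.
  rewrite ler_wpM2r ?sqr_ge0//.
  have := ler_wpM2l H0 vv; lra.
exact: key.
Unshelve. all: by end_near. Qed.

End AlmostLinear.

(** * The derivative of the flow in the initial point *)

Section DrivenFlow.
Variables (R : realType) (al be a b T : R).
Hypotheses (a0 : 0 < a) (T0 : 0 < T).
Local Notation V := ('cV[R]_2).

Local Notation f0 := (drift_x al be a b).
Local Notation f1 := (drift_y al be a b).
Local Notation L0 := (lin_x al be a b).
Local Notation L1 := (lin_y al be a b).
Local Notation driven := (driven_solution al be a b T).
Local Notation cmp M := (cmp_cst al be a b T M).
Local Notation growth M := (expR ((2 * osl_cst al a b M + 1) * T)).

Record driven_flow (n0 n1 : R -> R) (Phi : R -> V -> V) : Prop := DrivenFlow {
  flow_start : forall Z, Phi 0 Z = Z;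
  flow_driven : forall Z,
    driven n0 n1 (fun s => Phi s Z 0 0) (fun s => Phi s Z 1 0) }.

Lemma cmp_cst_ge2 M : 0 <= M -> 2 <= cmp M.
Proof.
move=> M0; rewrite /cmp_cst lerDr mulr_ge0 ?expR_ge0// mulr_ge0//.
by rewrite addr_ge0// mulr_ge0 ?lip_cst_ge0// ltW.
Qed.

Lemma lin_lip_cst_ge0 M : 0 <= M -> 0 <= lin_lip_cst a b M.
Proof.
move=> M0; rewrite /lin_lip_cst mulr_ge0//.
  by rewrite mulr_ge0// addr_ge0 ?sqr_ge0.
by rewrite addr_ge0// mulr_ge0.
Qed.

Section FixedNoise.
Variables (n0 n1 : R -> R) (Phi : R -> V -> V) (z : V) (M : R).
Hypotheses (hPhi : driven_flow n0 n1 Phi).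
Hypothesis hM : forall s, s \in `[0, T] ->
  Phi s z 0 0 ^+ 2 + Phi s z 1 0 ^+ 2 <= M.

Let T_in : T \in `[0, T]. Proof. by rewrite in_itv/= lexx ltW. Qed.
Let M0 : 0 <= M.
Proof.
by apply: le_trans (hM (s := 0) _); rewrite ?addr_ge0 ?sqr_ge0// in_itv/= lexx ltW.
Qed.

Let D v k s := Phi s (v + z) k 0 - Phi s z k 0.

Let D0 v k : D v k 0 = v k 0.
Proof. by rewrite /D !(flow_start hPhi) mxE addrK. Qed.

Lemma increment_bound v s : s \in `[0, T] ->
  D v 0 s ^+ 2 + D v 1 s ^+ 2 <= cmp M * sqn v.
Proof.
move=> sT.
have e01 : 0 <= (0 : R) <= 1 by rewrite lexx ler01.
have := driven_comparison a0 e01 (flow_driven hPhi z)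
  (flow_driven hPhi (v + z)) erefl erefl hM.
move=> /(_ _ s sT); rewrite -!/(D _ _ _) !D0 addr0; apply.
by move=> r _; rewrite !subrr expr0n /= addr0.
Qed.

Definition rem_cst : R := taylor_cst a b M * cmp M ^+ 2.

Lemma rem_cst_ge0 : 0 <= rem_cst.
Proof.
rewrite /rem_cst mulr_ge0 ?sqr_ge0// /taylor_cst mulr_ge0//.
  by rewrite mulr_ge0// addr_ge0 ?sqr_ge0.
by rewrite addr_ge0// mulr_ge0.
Qed.

Let rem0 v s := f0 (Phi s (v + z) 0 0) (Phi s (v + z) 1 0)
  - f0 (Phi s z 0 0) (Phi s z 1 0)
  - L0 (Phi s z 0 0) (Phi s z 1 0) (D v 0 s) (D v 1 s).
Let rem1 v s := f1 (Phi s (v + z) 0 0) (Phi s (v + z) 1 0)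
  - f1 (Phi s z 0 0) (Phi s z 1 0)
  - L1 (Phi s z 0 0) (Phi s z 1 0) (D v 0 s) (D v 1 s).

Lemma increment_remainder v s : cmp M * sqn v <= 1 -> s \in `[0, T] ->
  rem0 v s ^+ 2 + rem1 v s ^+ 2 <= rem_cst * sqn v ^+ 2.
Proof.
move=> v1 sT; have Dle := increment_bound v sT.
have := drift_taylor al be a b (hM sT) (le_trans Dle v1).
have e k : Phi s z k 0 + D v k s = Phi s (v + z) k 0 by rewrite /D addrC subrK.
rewrite !e -/(rem0 v s) -/(rem1 v s) => /le_trans; apply.
rewrite /rem_cst -mulrA -exprMn ler_wpM2l//.
  rewrite /taylor_cst mulr_ge0//.
    by rewrite mulr_ge0// addr_ge0 ?sqr_ge0.
  by rewrite addr_ge0// mulr_ge0.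
rewrite ler_pXn2r// nnegrE.
  by rewrite addr_ge0 ?sqr_ge0.
by apply: le_trans Dle; rewrite addr_ge0 ?sqr_ge0.
Qed.

Let D_cont v k : {within `[0, T], continuous (D v k)}.
Proof.
case: (ord2P k) => ->.
  exact: (within_continuousB (driven_cx (flow_driven hPhi (v + z)))
    (driven_cx (flow_driven hPhi z))).
exact: (within_continuousB (driven_cy (flow_driven hPhi (v + z)))
  (driven_cy (flow_driven hPhi z))).
Qed.

(* the common noise cancels in an increment *)
Let D_derive0 v s : s \in `]0, T[ -> is_derive s 1 (D v 0)
  (L0 (Phi s z 0 0) (Phi s z 1 0) (D v 0 s) (D v 1 s) + rem0 v s).
Proof.
move=> sT; have := driven_dx (flow_driven hPhi z) sT.
have := driven_dx (flow_driven hPhi (v + z)) sT => d1 d2.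
have := is_deriveB d1 d2.
rewrite [X in is_derive _ _ X _](_ : _ = D v 0); last first.
  by apply/funext => r; rewrite /D !fctE; ring.
by move=> ?; apply: is_derive_eq; rewrite /rem0; ring.
Qed.

Let D_derive1 v s : s \in `]0, T[ -> is_derive s 1 (D v 1)
  (L1 (Phi s z 0 0) (Phi s z 1 0) (D v 0 s) (D v 1 s) + rem1 v s).
Proof.
move=> sT; have := driven_dy (flow_driven hPhi z) sT.
have := driven_dy (flow_driven hPhi (v + z)) sT => d1 d2.
have := is_deriveB d1 d2.
rewrite [X in is_derive _ _ X _](_ : _ = D v 1); last first.
  by apply/funext => r; rewrite /D !fctE; ring.
by move=> ?; apply: is_derive_eq; rewrite /rem1; ring.
Qed.

Definition lin_cst : R := (1 + 3 * rem_cst * T) * growth M.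

Lemma lin_cst_ge0 : 0 <= lin_cst.
Proof.
have r0 := rem_cst_ge0; have := ltW T0 => T0'.
rewrite /lin_cst mulr_ge0 ?expR_ge0// addr_ge0//.
by apply: mulr_ge0 => //; apply: mulr_ge0.
Qed.

(** A linear combination of increments solves the linearised equation along the
base solution up to the Taylor remainders, which are quadratic in the initial
increments. *)
Lemma flow_almost_linear (c1 c2 c3 : R) (v1 v2 v3 : V) :
  cmp M * sqn v1 <= 1 -> cmp M * sqn v2 <= 1 -> cmp M * sqn v3 <= 1 ->
  sqn (c1 *: (Phi T (v1 + z) - Phi T z) + c2 *: (Phi T (v2 + z) - Phi T z)
       + c3 *: (Phi T (v3 + z) - Phi T z))
  <= lin_cst * (sqn (c1 *: v1 + c2 *: v2 + c3 *: v3)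
     + (c1 ^+ 2 * sqn v1 ^+ 2 + c2 ^+ 2 * sqn v2 ^+ 2
     + c3 ^+ 2 * sqn v3 ^+ 2)).
Proof.
move=> s1 s2 s3.
pose x k s := c1 * D v1 k s + c2 * D v2 k s + c3 * D v3 k s.
pose S := c1 ^+ 2 * sqn v1 ^+ 2 + c2 ^+ 2 * sqn v2 ^+ 2 + c3 ^+ 2 * sqn v3 ^+ 2.
have S0 : 0 <= S by rewrite !addr_ge0// mulr_ge0 ?sqr_ge0.
have rS0 : 0 <= 3 * rem_cst * S.
  by apply: mulr_ge0 => //; apply: mulr_ge0 => //; exact: rem_cst_ge0.
have x_cont k : {within `[0, T], continuous (x k)}.
  have cz c v := @within_continuousZ _ _ c _ (@D_cont v k).
  exact: (within_continuousD (within_continuousD (cz c1 v1) (cz c2 v2))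
    (cz c3 v3)).
have := linear_comparison (al := al) (be := be) (b := b) (r0 := fun s =>
    c1 * rem0 v1 s + c2 * rem0 v2 s + c3 * rem0 v3 s)
  (r1 := fun s => c1 * rem1 v1 s + c2 * rem1 v2 s + c3 * rem1 v3 s)
  a0 rS0 hM (x_cont 0) (x_cont 1).
move=> key.
have {key} : x 0 T ^+ 2 + x 1 T ^+ 2 <= (x 0 0 ^+ 2 + x 1 0 ^+ 2
    + 3 * rem_cst * S * T) * growth M.
  refine (key _ _ _ T T_in) => s sT.
  - have := D_derive0 v1 sT; have := D_derive0 v2 sT.
    have := D_derive0 v3 sT => d3 d2 d1.
    apply: is_derive_eq; rewrite /GRing.scale/= /x /lin_x; ring.
  - have := D_derive1 v1 sT; have := D_derive1 v2 sT.
    have := D_derive1 v3 sT => d3 d2 d1.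
    apply: is_derive_eq; rewrite /GRing.scale/= /x /lin_y; ring.
  - have sT' : s \in `[0, T].
      by move: sT; rewrite !in_itv/= => /andP[/ltW-> /ltW->].
    apply: le_trans (lerD (sum3_sqr_le _ _ _) (sum3_sqr_le _ _ _)) _.
    have i1 := ler_wpM2l (sqr_ge0 c1) (increment_remainder s1 sT').
    have i2 := ler_wpM2l (sqr_ge0 c2) (increment_remainder s2 sT').
    have i3 := ler_wpM2l (sqr_ge0 c3) (increment_remainder s3 sT').
    rewrite !exprMn /S; lra.
have -> : sqn (c1 *: (Phi T (v1 + z) - Phi T z)
    + c2 *: (Phi T (v2 + z) - Phi T z) + c3 *: (Phi T (v3 + z) - Phi T z))
  = x 0 T ^+ 2 + x 1 T ^+ 2 by rewrite /sqn /x /D !mxE.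
have -> : sqn (c1 *: v1 + c2 *: v2 + c3 *: v3) = x 0 0 ^+ 2 + x 1 0 ^+ 2.
  by rewrite /sqn /x !D0 !mxE.
move=> /le_trans; apply.
rewrite -/S /lin_cst [leRHS]mulrAC ler_wpM2r ?expR_ge0//.
set w := x 0 0 ^+ 2 + _; have w0 : 0 <= w by rewrite addr_ge0 ?sqr_ge0.
have c0 : 0 <= 3 * rem_cst * T.
  apply: mulr_ge0; last exact: ltW.
  by apply: mulr_ge0 => //; exact: rem_cst_ge0.
have := mulr_ge0 c0 w0; lra.
Qed.

Lemma flow_differential v : cmp M * sqn v <= 1 ->
  sqn (Phi T (v + z) - Phi T z - 'd (Phi T) z v) <= lin_cst * sqn v ^+ 2.
Proof.
have c2 := cmp_cst_ge2 M0.
have c0 : 0 < cmp M by exact: lt_le_trans c2.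
have e v' : (cmp M * sqn v' <= 1) = (sqn v' <= (cmp M)^-1).
  by rewrite mulrC -ler_pdivlMr// div1r.
rewrite e; apply: almost_linear_differentiable.
- by rewrite invr_gt0 c0 invf_le1// (le_trans _ c2)// ler1n.
- exact: lin_cst_ge0.
- by move=> ? ? ? ? ? ?; rewrite -!e; exact: flow_almost_linear.
Qed.

Section Reference.
Variables (p q u w : R -> R) (N B dl : R) (nu : V).
Hypotheses (dl0 : 0 <= dl) (dl1 : dl <= 1).
Hypothesis hN : forall s, s \in `[0, T] -> p s ^+ 2 + q s ^+ 2 <= N.
Hypothesis hdl : forall s, s \in `[0, T] ->
  (Phi s z 0 0 - p s) ^+ 2 + (Phi s z 1 0 - q s) ^+ 2 <= dl.
Hypothesis hB : forall s, s \in `[0, T] -> u s ^+ 2 + w s ^+ 2 <= B.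
Hypotheses (cu : {within `[0, T], continuous u})
  (cw : {within `[0, T], continuous w}).
Hypothesis du : forall s, s \in `]0, T[ ->
  is_derive s 1 u (L0 (p s) (q s) (u s) (w s)).
Hypothesis dw : forall s, s \in `]0, T[ ->
  is_derive s 1 w (L1 (p s) (q s) (u s) (w s)).
Hypotheses (u0 : u 0 = nu 0 0) (w0 : w 0 = nu 1 0).

(** The difference quotient and the reference solution [(u, w)] solve linearised
equations along two curves at squared distance at most [dl].  Their difference
is a solution along the first curve, with an inhomogeneous term made of the
Taylor remainder and of the difference of the two linearisations applied to
[(u, w)]. *)
Lemma quotient_close h : 0 < h -> cmp M * sqn (h *: nu) <= 1 ->
  (h^-1 * D (h *: nu) 0 T - u T) ^+ 2 + (h^-1 * D (h *: nu) 1 T - w T) ^+ 2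
  <= (2 * (lin_lip_cst a b N * (dl * B)) + 2 * rem_cst * sqn nu ^+ 2 * h ^+ 2)
     * T * growth M.
Proof.
move=> h0 hnu.
have N0 : 0 <= N.
  by apply: le_trans (hN (s := 0) _);
    rewrite ?addr_ge0 ?sqr_ge0// in_itv/= lexx ltW.
have B0 : 0 <= B.
  by apply: le_trans (hB (s := 0) _);
    rewrite ?addr_ge0 ?sqr_ge0// in_itv/= lexx ltW.
have ll0 : 0 <= lin_lip_cst a b N by exact: lin_lip_cst_ge0.
set c := 2 * _ + _.
have c0 : 0 <= c.
  rewrite /c addr_ge0//; first by rewrite mulr_ge0// mulr_ge0// mulr_ge0.
  rewrite mulr_ge0 ?sqr_ge0// mulr_ge0 ?sqr_ge0//.
  by rewrite mulr_ge0// rem_cst_ge0.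
pose g0 s := L0 (Phi s z 0 0) (Phi s z 1 0) (u s) (w s)
  - L0 (p s) (q s) (u s) (w s).
pose g1 s := L1 (Phi s z 0 0) (Phi s z 1 0) (u s) (w s)
  - L1 (p s) (q s) (u s) (w s).
pose x s := h^-1 * D (h *: nu) 0 s - u s.
pose y s := h^-1 * D (h *: nu) 1 s - w s.
have cx : {within `[0, T], continuous x}.
  exact: (within_continuousB (@within_continuousZ _ _ h^-1 _ (@D_cont (h *: nu) 0)) cu).
have cy : {within `[0, T], continuous y}.
  exact: (within_continuousB (@within_continuousZ _ _ h^-1 _ (@D_cont (h *: nu) 1)) cw).
have := linear_comparison (al := al) (be := be) (b := b)
  (r0 := fun s => h^-1 * rem0 (h *: nu) s + g0 s)
  (r1 := fun s => h^-1 * rem1 (h *: nu) s + g1 s) a0 c0 hM cx cy.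
move=> key.
have {key} := key _ _ _ T T_in.
have -> : x 0 = 0 by rewrite /x D0 u0 mxE mulKf ?subrr// gt_eqF.
have -> : y 0 = 0 by rewrite /y D0 w0 mxE mulKf ?subrr// gt_eqF.
rewrite expr0n /= !add0r; apply => s sT.
- have := D_derive0 (h *: nu) sT; have := du sT => d1 d2.
  apply: is_derive_eq; rewrite /GRing.scale/= /x /y /g0 /lin_x; ring.
- have := D_derive1 (h *: nu) sT; have := dw sT => d1 d2.
  apply: is_derive_eq; rewrite /GRing.scale/= /x /y /g1 /lin_y; ring.
have sT' : s \in `[0, T].
  by move: sT; rewrite !in_itv/= => /andP[/ltW-> /ltW->].
have A := increment_remainder hnu sT'.
have C : g0 s ^+ 2 + g1 s ^+ 2 <= lin_lip_cst a b N * (dl * B).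
  have := linearization_lipschitz al be a b (u s) (w s) (hN sT')
    (le_trans (hdl sT') dl1).
  rewrite !(addrC _ (_ - _)) !subrK -/(g0 s) -/(g1 s) => /le_trans; apply.
  by rewrite ler_wpM2l// ler_pM ?addr_ge0 ?sqr_ge0// ?hdl ?hB.
have A' : h^-1 ^+ 2 * (rem0 (h *: nu) s ^+ 2 + rem1 (h *: nu) s ^+ 2) <=
    rem_cst * sqn nu ^+ 2 * h ^+ 2.
  have -> : rem_cst * sqn nu ^+ 2 * h ^+ 2 =
      h^-1 ^+ 2 * (rem_cst * sqn (h *: nu) ^+ 2).
    by rewrite sqnZ; field; rewrite gt_eqF.
  by rewrite ler_wpM2l ?sqr_ge0.
rewrite /c.
have := sqr_ge0 (h^-1 * rem0 (h *: nu) s - g0 s).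
have := sqr_ge0 (h^-1 * rem1 (h *: nu) s - g1 s).
nra.
Qed.

(** The difference quotient is replaced by its limit as [h] tends to 0. *)
Lemma differential_close :
  ('d (Phi T) z nu 0 0 - u T) ^+ 2 + ('d (Phi T) z nu 1 0 - w T) ^+ 2
  <= 4 * (lin_lip_cst a b N * (dl * B)) * T * growth M.
Proof.
set Q := 4 * _ * T * _.
pose C := 2 * lin_cst * sqn nu ^+ 2
  + 4 * rem_cst * sqn nu ^+ 2 * T * growth M.
have C0 : 0 <= C.
  have l0 := lin_cst_ge0; have r0 := rem_cst_ge0; have T0' := ltW T0.
  rewrite /C addr_ge0//; first by rewrite mulr_ge0 ?sqr_ge0// mulr_ge0.
  rewrite mulr_ge0 ?expR_ge0// mulr_ge0// mulr_ge0 ?sqr_ge0//.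
  by rewrite mulr_ge0.
have c0 : 0 < cmp M by apply: lt_le_trans (cmp_cst_ge2 M0).
have main h : 0 < h -> cmp M * sqn (h *: nu) <= 1 ->
  ('d (Phi T) z nu 0 0 - u T) ^+ 2 + ('d (Phi T) z nu 1 0 - w T) ^+ 2
  <= Q + C * h ^+ 2.
  move=> h0 hnu; have A := quotient_close h0 hnu.
  have B' := ler_wpM2l (sqr_ge0 h^-1) (flow_differential hnu).
  have dE : 'd (Phi T) z (h *: nu) = h *: 'd (Phi T) z nu by exact: linearZ.
  rewrite -sqnZ scalerBr dE scalerA mulVf ?gt_eqF// scale1r in B'.
  have e : h^-1 ^+ 2 * (lin_cst * sqn (h *: nu) ^+ 2) =
      lin_cst * sqn nu ^+ 2 * h ^+ 2.
    by rewrite sqnZ; field; rewrite gt_eqF.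
  rewrite e /sqn !mxE -!/(D _ _ _) in B'.
  set d0 := 'd (Phi T) z nu 0 0 in B' *.
  set d1 := 'd (Phi T) z nu 1 0 in B' *.
  rewrite -/(sqn nu) in B'.
  move: A B'; set x := h^-1 * D _ 0 T; set y := h^-1 * D _ 1 T => A B'.
  have -> : Q + C * h ^+ 2 = 2 * ((2 * (lin_lip_cst a b N * (dl * B))
     + 2 * rem_cst * sqn nu ^+ 2 * h ^+ 2) * T * growth M)
     + 2 * (lin_cst * sqn nu ^+ 2 * h ^+ 2).
    by rewrite /Q /C; ring.
  have := sqr_ge0 ((x - u T) + (x - d0)).
  have := sqr_ge0 ((y - w T) + (y - d1)).
  nra.
(* let h tend to 0 *)
apply/ler_addgt0Pr => e e0.
pose h := Num.min 1 (Num.min (e / (C + 1)) (cmp M * (sqn nu + 1))^-1).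
have C1 : 0 < C + 1 by rewrite ltr_wpDl.
have nu1 : 0 < sqn nu + 1 by rewrite ltr_wpDl ?sqn_ge0.
have cn : 0 < cmp M * (sqn nu + 1) by exact: mulr_gt0.
have h0 : 0 < h by rewrite !lt_min ltr01 divr_gt0// invr_gt0.
have h1 : h <= 1 by rewrite ge_min lexx.
have he : h * (C + 1) <= e.
  by rewrite -ler_pdivlMr// !ge_min lexx /= orbT.
have hc : h * (cmp M * (sqn nu + 1)) <= 1.
  by rewrite -ler_pdivlMr// div1r !ge_min lexx /= !orbT.
apply: le_trans (main h h0 _) _.
  rewrite sqnZ; have := sqn_ge0 nu => s0.
  have hh : h ^+ 2 <= h by nra.
  have := ler_wpM2r (mulr_ge0 (ltW c0) s0) hh; nra.
rewrite lerD2l; have hh : h ^+ 2 <= h by nra.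
have := ler_wpM2l C0 hh; nra.
Qed.

End Reference.
End FixedNoise.

(** Stability of the derivative of the flow: all bounds on the solution near the
reference curve follow from bounds on the reference curve alone. *)
Lemma differential_near_reference (m0 m1 p q u w : R -> R) (z nu : V) (eta : R) :
  0 < eta -> driven m0 m1 p q -> p 0 = z 0 0 -> q 0 = z 1 0 ->
  {within `[0, T], continuous u} -> {within `[0, T], continuous w} ->
  (forall s, s \in `]0, T[ -> is_derive s 1 u (L0 (p s) (q s) (u s) (w s))) ->
  (forall s, s \in `]0, T[ -> is_derive s 1 w (L1 (p s) (q s) (u s) (w s))) ->
  u 0 = nu 0 0 -> w 0 = nu 1 0 ->
  exists2 e : R, 0 < e & forall n0 n1 Phi, driven_flow n0 n1 Phi ->
    n0 0 = m0 0 -> n1 0 = m1 0 ->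
    (forall s, s \in `[0, T] ->
       (n0 s - m0 s) ^+ 2 + (n1 s - m1 s) ^+ 2 <= e) ->
    ('d (Phi T) z nu 0 0 - u T) ^+ 2 + ('d (Phi T) z nu 1 0 - w T) ^+ 2 <= eta.
Proof.
move=> eta0 pq p0 q0 cu cw du dw u0 w0.
have bnd (f g : R -> R) : {within `[0, T], continuous f} ->
    {within `[0, T], continuous g} ->
    exists2 N, 0 <= N & forall s, s \in `[0, T] -> f s ^+ 2 + g s ^+ 2 <= N.
  move=> cf cg.
  have cfg : {within `[0, T], continuous (fun s => f s ^+ 2 + g s ^+ 2)}.
    by apply: within_continuousD; apply: within_continuousM.
  have [c _ hc] := EVT_max (ltW T0) cfg.
  by exists (f c ^+ 2 + g c ^+ 2) => //; rewrite addr_ge0 ?sqr_ge0.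
have [N N0 hN] := bnd _ _ (driven_cx pq) (driven_cy pq).
have [B B0 hB] := bnd _ _ cu cw.
have c2 := cmp_cst_ge2 N0.
have c0 : 0 < cmp N by exact: lt_le_trans c2.
pose M := 2 * N + 2.
pose Q := 4 * (lin_lip_cst a b N * B) * T * growth M.
have Q0 : 0 <= Q.
  rewrite /Q mulr_ge0 ?expR_ge0// mulr_ge0 ?(ltW T0)//.
  by rewrite mulr_ge0// mulr_ge0// lin_lip_cst_ge0.
(* the first term keeps the solution within distance one of the reference *)
pose e := Num.min (cmp N)^-1 (eta / (cmp N * (Q + 1))).
have Q1 : 0 < Q + 1 by rewrite ltr_wpDl.
have cQ : 0 < cmp N * (Q + 1) by rewrite mulr_gt0.
have e0 : 0 < e by rewrite lt_min invr_gt0 c0 divr_gt0.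
have e1 : cmp N * e <= 1.
  by rewrite mulrC -ler_pdivlMr// div1r ge_min lexx.
have e2 : e * (cmp N * (Q + 1)) <= eta.
  by rewrite -ler_pdivlMr// ge_min lexx orbT.
exists e => // n0 n1 Phi hPhi nm0 nm1 hnm.
have e01 : 0 <= e <= 1.
  rewrite ltW//=; apply: le_trans e1; rewrite ler_peMl ?ltW//; lra.
have close := driven_comparison a0 e01 pq (flow_driven hPhi z)
  (esym nm0) (esym nm1) hN hnm.
have {}close s : s \in `[0, T] ->
    (Phi s z 0 0 - p s) ^+ 2 + (Phi s z 1 0 - q s) ^+ 2 <= cmp N * e.
  move=> sT; apply: le_trans (close s sT) _.
  by rewrite !(flow_start hPhi) p0 q0 !subrr expr0n /= !add0r.
have hM s : s \in `[0, T] -> Phi s z 0 0 ^+ 2 + Phi s z 1 0 ^+ 2 <= M.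
  move=> sT; have := le_trans (close s sT) e1; have := hN s sT; rewrite /M.
  set P0 := Phi s z 0 0; set P1 := Phi s z 1 0.
  have := sqr_ge0 (2 * p s - P0); have := sqr_ge0 (2 * q s - P1); nra.
apply: le_trans (differential_close hPhi hM _ e1 hN close hB cu cw du dw u0 w0) _.
  by rewrite mulr_ge0 ?ltW.
have -> : 4 * (lin_lip_cst a b N * (cmp N * e * B)) * T * growth M =
  cmp N * e * Q by rewrite /Q; ring.
have := mulr_gt0 c0 e0; lra.
Qed.

End DrivenFlow.

(** * The reference spiral *)

Section ReferencePath.
Variables (R : realType) (al be a b T : R).
Hypotheses (T0 : 0 < T).
Local Notation V := ('cV[R]_2).

Local Notation f0 := (drift_x al be a b).
Local Notation f1 := (drift_y al be a b).
Local Notation L0 := (lin_x al be a b).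
Local Notation L1 := (lin_y al be a b).
Local Notation driven := (driven_solution al be a b T).

Lemma polar (z : V) : exists r c d : R,
  [/\ c ^+ 2 + d ^+ 2 = 1, z 0 0 = r * c & z 1 0 = r * d].
Proof.
have [z0|z0] := eqVneq (sqn z) 0.
  exists 0, 1, 0; rewrite !mul0r expr1n expr0n addr0; split => //.
    by have := sqr_ge0 (z 0 0); have := sqr_ge0 (z 1 0);
      move: z0; rewrite /sqn; nra.
  by have := sqr_ge0 (z 0 0); have := sqr_ge0 (z 1 0);
    move: z0; rewrite /sqn; nra.
have r0 : Num.sqrt (sqn z) != 0.
  by rewrite sqrtr_eq0 -ltNge lt_def z0 sqn_ge0.
exists (Num.sqrt (sqn z)), (z 0 0 / Num.sqrt (sqn z)),
  (z 1 0 / Num.sqrt (sqn z)); split.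
- rewrite !expr_div_n -mulrDl sqr_sqrtr ?sqn_ge0// divff//.
- by rewrite mulrC divfK.
- by rewrite mulrC divfK.
Qed.

Section Spiral.
Variables (r k c d lam mu nu : R).
Hypotheses (cd1 : c ^+ 2 + d ^+ 2 = 1) (munu1 : mu ^+ 2 + nu ^+ 2 = 1).
Hypotheses (eig0 : 3 * a * mu + b * nu = - lam * mu)
  (eig1 : b * mu + a * nu = - lam * nu).

Definition radius (s : R) := r + k * s.
(** The integral of [radius ^+ 2] from 0. *)
Definition radius_sqr_int (s : R) :=
  r ^+ 2 * s + r * k * s ^+ 2 + k ^+ 2 / 3 * s ^+ 3.
(** This angular velocity is the one for which the linearisation in the moving
frame is a combination of the identity and one fixed symmetric matrix. *)
Definition angle (s : R) := be * s - 2 * b * radius_sqr_int s.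
Definition dir0 (s : R) := c * cos (angle s) - d * sin (angle s).
Definition dir1 (s : R) := d * cos (angle s) + c * sin (angle s).
Definition gain (s : R) := expR (al * s + lam * radius_sqr_int s).
Definition spiral0 s := radius s * dir0 s.
Definition spiral1 s := radius s * dir1 s.
(** The solution of the linearised equation that stays in the direction of the
eigenvector [(mu, nu)] in the frame ([dir], [dir] turned by a right angle). *)
Definition mode0 s := gain s * (mu * dir0 s - nu * dir1 s).
Definition mode1 s := gain s * (mu * dir1 s + nu * dir0 s).

Lemma dir_unit s : dir0 s ^+ 2 + dir1 s ^+ 2 = 1.
Proof.
rewrite /dir0 /dir1 -[RHS]cd1 -[RHS]mulr1 -(cos2Dsin2 (angle s)); ring.
Qed.

Lemma radius_sqr_int_derive (s : R) : is_derive s 1 radius_sqr_int (radius s ^+ 2).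
Proof.
rewrite /radius_sqr_int; apply: is_derive_eq.
by rewrite /GRing.scale/= /radius; field.
Qed.

Lemma angle_derive (s : R) : is_derive s 1 angle (be - 2 * b * radius s ^+ 2).
Proof.
have ? := radius_sqr_int_derive s.
by rewrite /angle; apply: is_derive_eq; rewrite /GRing.scale/=; ring.
Qed.

Lemma dir0_derive (s : R) :
  is_derive s 1 dir0 (- (be - 2 * b * radius s ^+ 2) * dir1 s).
Proof.
have h := angle_derive s.
have hc := is_derive1_comp (f := cos) (g := angle).
have hs := is_derive1_comp (f := sin) (g := angle).
have dc : is_derive s 1 (fun s => cos (angle s))
    (- sin (angle s) * (be - 2 * b * radius s ^+ 2)) by exact: hc.
have ds : is_derive s 1 (fun s => sin (angle s))
    (cos (angle s) * (be - 2 * b * radius s ^+ 2)) by exact: hs.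
by rewrite /dir0; apply: is_derive_eq; rewrite /GRing.scale/= /dir1; ring.
Qed.

Lemma dir1_derive (s : R) :
  is_derive s 1 dir1 ((be - 2 * b * radius s ^+ 2) * dir0 s).
Proof.
have h := angle_derive s.
have hc := is_derive1_comp (f := cos) (g := angle).
have hs := is_derive1_comp (f := sin) (g := angle).
have dc : is_derive s 1 (fun s => cos (angle s))
    (- sin (angle s) * (be - 2 * b * radius s ^+ 2)) by exact: hc.
have ds : is_derive s 1 (fun s => sin (angle s))
    (cos (angle s) * (be - 2 * b * radius s ^+ 2)) by exact: hs.
by rewrite /dir1; apply: is_derive_eq; rewrite /GRing.scale/= /dir0; ring.
Qed.

Lemma gain_derive (s : R) :
  is_derive s 1 gain ((al + lam * radius s ^+ 2) * gain s).
Proof.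
have h := radius_sqr_int_derive s.
have dl : is_derive s 1 (fun s => al * s + lam * radius_sqr_int s)
    (al + lam * radius s ^+ 2).
  by apply: is_derive_eq; rewrite /GRing.scale/=; ring.
have := is_derive1_comp (f := expR)
  (g := fun s => al * s + lam * radius_sqr_int s) (x := s).
move=> /(_ _ _ _ dl) dE.
by rewrite /gain; apply: is_derive_eq; rewrite mulrC.
Qed.

Let modes s : spiral0 s ^+ 2 + spiral1 s ^+ 2 = radius s ^+ 2 /\
  spiral0 s * mode0 s + spiral1 s * mode1 s = radius s * gain s * mu.
Proof.
rewrite /spiral0 /spiral1 /mode0 /mode1; split.
  by rewrite -[RHS]mulr1 -(dir_unit s); ring.
by rewrite -[RHS]mulr1 -(dir_unit s); ring.
Qed.

(** The quadratic invariants in [modes] remove all products of directions; what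
is left is a combination of the two eigenvector equations. *)
Lemma mode0_derive (s : R) : is_derive s 1 mode0
  (L0 (spiral0 s) (spiral1 s) (mode0 s) (mode1 s)).
Proof.
have ? := gain_derive s; have ? := dir0_derive s; have ? := dir1_derive s.
rewrite /mode0; apply: is_derive_eq; rewrite /GRing.scale/= -/(mode0 s).
have [e1 e2] := modes s; rewrite /lin_x e1 e2.
rewrite /mode0 /mode1 /spiral0 /spiral1.
apply/eqP; rewrite -subr_eq0; apply/eqP.
rewrite [LHS](_ : _ = gain s * radius s ^+ 2 *
  (dir0 s * (lam * mu + (3 * a * mu + b * nu))
   - dir1 s * (lam * nu + (b * mu + a * nu)))); last by ring.
by rewrite eig0 eig1; ring.
Qed.

Lemma mode1_derive (s : R) : is_derive s 1 mode1
  (L1 (spiral0 s) (spiral1 s) (mode0 s) (mode1 s)).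
Proof.
have ? := gain_derive s; have ? := dir0_derive s; have ? := dir1_derive s.
rewrite /mode1; apply: is_derive_eq; rewrite /GRing.scale/= -/(mode1 s).
have [e1 e2] := modes s; rewrite /lin_y e1 e2.
rewrite /mode0 /mode1 /spiral0 /spiral1.
apply/eqP; rewrite -subr_eq0; apply/eqP.
rewrite [LHS](_ : _ = gain s * radius s ^+ 2 *
  (dir1 s * (lam * mu + (3 * a * mu + b * nu))
   + dir0 s * (lam * nu + (b * mu + a * nu)))); last by ring.
by rewrite eig0 eig1; ring.
Qed.

Lemma mode_norm s : mode0 s ^+ 2 + mode1 s ^+ 2 = gain s ^+ 2.
Proof.
rewrite /mode0 /mode1 -[RHS]mulr1 -(dir_unit s) -[RHS]mulr1 -munu1; ring.
Qed.

Lemma is_derive_continuous (f f' : R -> R) :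
  (forall s : R, is_derive s 1 f (f' s)) -> continuous f.
Proof.
by move=> df s; apply/differentiable_continuous/derivable1_diffP; case: (df s).
Qed.

Lemma spiral0_continuous : continuous spiral0.
Proof.
apply: (@is_derive_continuous _ (fun s => radius s *
  (- (be - 2 * b * radius s ^+ 2) * dir1 s) + dir0 s * k)) => s.
have ? := dir0_derive s; rewrite /spiral0 /radius.
by apply: is_derive_eq; rewrite /GRing.scale/= /radius; ring.
Qed.

Lemma spiral1_continuous : continuous spiral1.
Proof.
apply: (@is_derive_continuous _ (fun s => radius s *
  ((be - 2 * b * radius s ^+ 2) * dir0 s) + dir1 s * k)) => s.
have ? := dir1_derive s; rewrite /spiral1 /radius.
by apply: is_derive_eq; rewrite /GRing.scale/= /radius; ring.
Qed.

End Spiral.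

Lemma within_integral_derive (g : R -> R) : {within `[0, T], continuous g} ->
  {within `[0, T], continuous
    (fun s => \int[lebesgue_measure]_(t in `[0, s]) g t)} /\
  forall s, s \in `]0, T[ -> is_derive s 1
    (fun s => \int[lebesgue_measure]_(t in `[0, s]) g t) (g s).
Proof.
move=> cg.
have ig : (@lebesgue_measure R).-integrable `[0, T] (EFin \o g).
  by apply: continuous_compact_integrable => //; exact: segment_compact.
split; first exact: parameterized_integral_continuous (ltW T0) ig.
move=> s sT; move: (sT); rewrite in_itv/= => /andP[s0 sT'].
have := @continuous_FTC1_closed R g 0 s T sT' ig s0.
have cs : {for s, continuous g}.
  by move: cg => /(continuous_within_itvP _ T0)[cg _ _]; exact: cg.
by move=> /(_ cs)[d1 d2]; split; [exact: d1|rewrite -derive1E; exact: d2].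
Qed.

(** The forcing [(m0, m1)] is chosen so that the spiral solves the driven
equation. *)
Lemma reference_path (z : V) (lam mu nu k : R) : mu ^+ 2 + nu ^+ 2 = 1 ->
  3 * a * mu + b * nu = - lam * mu -> b * mu + a * nu = - lam * nu ->
  exists r (m0 m1 p q u w : R -> R),
  [/\ driven m0 m1 p q, [/\ m0 0 = 0, m1 0 = 0, p 0 = z 0 0 & q 0 = z 1 0],
      {within `[0, T], continuous u} /\ {within `[0, T], continuous w},
      (forall s, s \in `]0, T[ -> is_derive s 1 u (L0 (p s) (q s) (u s) (w s)))
      /\
      (forall s, s \in `]0, T[ -> is_derive s 1 w (L1 (p s) (q s) (u s) (w s)))
      & u 0 ^+ 2 + w 0 ^+ 2 = 1 /\ u T ^+ 2 + w T ^+ 2 =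
        expR (al * T + lam * (r ^+ 2 * T + r * k * T ^+ 2
          + k ^+ 2 / 3 * T ^+ 3)) ^+ 2].
Proof.
move=> munu1 eig0 eig1; have [r [c [d [cd1 z0 z1]]]] := polar z.
pose p := spiral0 r k c d; pose q := spiral1 r k c d.
pose u := mode0 r k c d lam mu nu; pose w := mode1 r k c d lam mu nu.
have cp : continuous p by exact: spiral0_continuous.
have cq : continuous q by exact: spiral1_continuous.
have cF0 : continuous (fun s => f0 (p s) (q s)).
  move=> s; rewrite /drift_x.
  apply: cvgB; first by apply: cvgB; apply: cvgM; first
    [exact: cvg_cst|exact: cp|exact: cq].
  apply: cvgM; first by apply: cvgD; apply: cvgM; first [exact: cp|exact: cq].
  by apply: cvgB; apply: cvgM; first
    [exact: cvg_cst|exact: cp|exact: cq].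
have cF1 : continuous (fun s => f1 (p s) (q s)).
  move=> s; rewrite /drift_y.
  apply: cvgB; first by apply: cvgD; apply: cvgM; first
    [exact: cvg_cst|exact: cp|exact: cq].
  apply: cvgM; first by apply: cvgD; apply: cvgM; first [exact: cp|exact: cq].
  by apply: cvgD; apply: cvgM; first
    [exact: cvg_cst|exact: cp|exact: cq].
have [ci0 di0] := within_integral_derive (continuous_subspaceT cF0).
have [ci1 di1] := within_integral_derive (continuous_subspaceT cF1).
set I0 := (X in {within _, continuous X}) in ci0.
set I1 := (X in {within _, continuous X}) in ci1.
pose m0 s := p s - z 0 0 - I0 s; pose m1 s := q s - z 1 0 - I1 s.
have ang0 : angle r k 0 = 0 by rewrite /angle /radius_sqr_int; ring.
have p0 : p 0 = z 0 0.
  by rewrite z0 /p /spiral0 /dir0 ang0 cos0 sin0 /radius; ring.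
have q0 : q 0 = z 1 0.
  by rewrite z1 /q /spiral1 /dir1 ang0 cos0 sin0 /radius; ring.
have I00 : I0 0 = 0 by rewrite /I0 set_itv1 Rintegral_set1.
have I10 : I1 0 = 0 by rewrite /I1 set_itv1 Rintegral_set1.
have cc (x : R) : {within `[0, T], continuous (fun=> x)}.
  by apply: continuous_subspaceT => s; exact: cvg_cst.
exists r, m0, m1, p, q, u, w; split.
- split; try exact: continuous_subspaceT.
  + apply: within_continuousB ci0.
    exact: within_continuousB (continuous_subspaceT cp) (cc _).
  + apply: within_continuousB ci1.
    exact: within_continuousB (continuous_subspaceT cq) (cc _).
  + move=> s sT; have ? := di0 s sT.
    rewrite (_ : (fun s => _) = (fun s => z 0 0 + I0 s)); last first.
      by apply/funext => ?; rewrite /m0; ring.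
    by apply: is_derive_eq; rewrite add0r mul1r.
  + move=> s sT; have ? := di1 s sT.
    rewrite (_ : (fun s => _) = (fun s => z 1 0 + I1 s)); last first.
      by apply/funext => ?; rewrite /m1; ring.
    by apply: is_derive_eq; rewrite add0r mul1r.
- by rewrite /m0 /m1 p0 q0 I00 I10 !subrr.
- split; apply: continuous_subspaceT.
    by apply: is_derive_continuous => s; exact: mode0_derive.
  by apply: is_derive_continuous => s; exact: mode1_derive.
- by split => s _; [exact: mode0_derive|exact: mode1_derive].
- rewrite !mode_norm//; split => //.
  rewrite /gain (_ : _ + _ = 0) ?expR0 ?expr1n//.
  by rewrite /radius_sqr_int; ring.
Qed.

End ReferencePath.

(** * Gaussian estimates *)

Section GaussianBounds.
Variable R : realType.
Implicit Types s x c h : R.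

Lemma measurable_normr_gt x : measurable [set y : R | x < `|y|].
Proof.
have -> : [set y : R | x < `|y|] = (fun y => `|y|) @^-1` `]x, +oo[.
  by apply/seteqP; split=> y /=; rewrite in_itv/= andbT.
by rewrite -[X in measurable X]setTI; apply: normr_measurable.
Qed.

Lemma ball_itvE c h : [set y : R | `|y - c| <= h] = `[c - h, c + h]%classic.
Proof.
by apply/seteqP; split=> y /=; rewrite in_itv/= ler_distl.
Qed.

(** The density of standard deviation [s] is at most [sqrt 2 exp (- x^2 / 4 s^2)]
times the density of standard deviation [sqrt 2 * s] outside [[- x, x]]: half
of the exponent is bounded on this set, the other half is the wider density. *)
Lemma normal_tail s x : 0 < s -> 0 <= x ->
  (normal_prob 0 s [set y : R | (x < `|y|)%R]
   <= (Num.sqrt 2 * expR (- (x ^+ 2 / (4 * s ^+ 2))))%:E)%E.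
Proof.
move=> s0 x0; set A := [set y | _].
have mA : measurable A by exact: measurable_normr_gt.
pose s' := Num.sqrt 2 * s.
have r2 : 0 < Num.sqrt 2 :> R by rewrite sqrtr_gt0.
have s'0 : 0 < s' by rewrite mulr_gt0.
have s'2 : s' ^+ 2 = 2 * s ^+ 2 by rewrite exprMn sqr_sqrtr.
set c := Num.sqrt 2 * _.
have c0 : 0 <= c by rewrite mulr_ge0 ?expR_ge0// ltW.
have peakE : normal_peak s = Num.sqrt 2 * normal_peak s'.
  rewrite /normal_peak s'2.
  have -> : 2 * s ^+ 2 * pi *+ 2 = 2 * (s ^+ 2 * pi *+ 2) by ring.
  by rewrite sqrtrM// invfM mulrA divff ?mul1r// gt_eqF.
have pdf_le y : A y -> normal_pdf 0 s y <= c * normal_pdf 0 s' y.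
  move=> xy; rewrite !normal_pdfE ?gt_eqF// peakE /c.
  have -> : Num.sqrt 2 * expR (- (x ^+ 2 / (4 * s ^+ 2))) *
      (normal_peak s' * normal_fun 0 s' y) =
      Num.sqrt 2 * normal_peak s' *
      (expR (- (x ^+ 2 / (4 * s ^+ 2))) * normal_fun 0 s' y) by ring.
  rewrite ler_wpM2l//; first by rewrite mulr_ge0 ?normal_peak_ge0// ltW.
  rewrite /normal_fun -expRD ler_expR !subr0 s'2.
  have xy2 : x ^+ 2 <= y ^+ 2.
    by rewrite -(real_normK (num_real y)) ler_pXn2r ?nnegrE// ltW.
  have -> : - y ^+ 2 / (s ^+ 2 *+ 2) = - (y ^+ 2 / (4 * s ^+ 2))
      + - y ^+ 2 / (2 * s ^+ 2 *+ 2) by field; rewrite gt_eqF.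
  rewrite lerD2r lerN2 ler_wpM2r// invr_ge0 mulr_ge0// sqr_ge0//.
rewrite /normal_prob.
apply: (@le_trans _ _ (\int[lebesgue_measure]_(y in A)
    (c%:E * (normal_pdf 0 s' y)%:E))%E).
  apply: ge0_le_integral => //.
  - by move=> y _; rewrite lee_fin normal_pdf_ge0.
  - apply/measurable_EFinP/measurable_funTS; exact: measurable_normal_pdf.
  - apply: emeasurable_funM => //.
    apply/measurable_EFinP/measurable_funTS; exact: measurable_normal_pdf.
rewrite ge0_integralZl_EFin//; last 2 first.
- by move=> y _; rewrite lee_fin normal_pdf_ge0.
- apply/measurable_EFinP/measurable_funTS; exact: measurable_normal_pdf.
rewrite -[leRHS]mule1 lee_wpmul2l ?lee_fin//.
exact: (@probability_le1 _ _ _ (normal_prob 0 s') A mA).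
Qed.

Lemma normal_ball_ge s c h k : 0 < s -> 0 < h -> `|c| + h <= k ->
  ((2 * h * normal_peak s * expR (- (k ^+ 2 / (2 * s ^+ 2))))%:E
   <= normal_prob 0 s [set y : R | (`|y - c| <= h)%R])%E.
Proof.
move=> s0 h0 chk; rewrite ball_itvE /normal_prob.
set e := expR _.
have ch : c - h <= c + h by rewrite lerD2l; lra.
apply: (@le_trans _ _ (\int[lebesgue_measure]_(y in `[(c - h)%R, (c + h)%R])
    (normal_peak s * e)%:E)%E).
  rewrite integral_cst//= lebesgue_measure_itv/= lte_fin.
  have -> : (c - h < c + h) = true by rewrite ltrD2l; lra.
  by rewrite -EFinD -EFinM lee_fin; lra.
apply: ge0_le_integral => //.
- by move=> y _; rewrite lee_fin mulr_ge0 ?expR_ge0// normal_peak_ge0.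
- apply/measurable_EFinP/measurable_funTS; exact: measurable_normal_pdf.
- move=> y /=; rewrite in_itv/= => /andP[y1 y2]; rewrite lee_fin.
  rewrite normal_pdfE ?gt_eqF// ler_wpM2l ?normal_peak_ge0//.
  rewrite /e /normal_fun ler_expR subr0 mulNr lerN2.
  have -> : s ^+ 2 *+ 2 = 2 * s ^+ 2 by ring.
  rewrite ler_wpM2r//; first by rewrite invr_ge0 mulr_ge0// sqr_ge0.
  have yk : `|y| <= k.
    apply: le_trans chk; have := ler_norm c; have := ler_norm (- c).
    by rewrite normrN ler_norml => *; apply/andP; split; lra.
  by rewrite -(real_normK (num_real y)) ler_pXn2r ?nnegrE// (le_trans _ yk).
Qed.

End GaussianBounds.

(** * Independence of past and future *)

Section PiLambda.
Context d (T : measurableType d) (R : realType) (P : probability T R).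
Local Open Scope ereal_scope.

(** Both sides are finite measures in [A] that agree on a pi-system. *)
Let independent_one (G : set_system T) (B : set T) :
  G `<=` measurable -> setI_closed G -> G setT -> measurable B ->
  (forall A, G A -> P (A `&` B) = P A * P B) ->
  forall A, <<s G >> A -> P (A `&` B) = P A * P B.
Proof.
move=> Gm GI GT mB h A sA.
have PB0 : (0 <= fine (P B))%R by rewrite fine_ge0.
have mPB E : mscale (NngNum PB0) P E = P E * P B.
  by rewrite /mscale/= fineK ?fin_num_measure// muleC.
rewrite -[RHS]mPB.
apply: (@g_sigma_algebra_measure_unique _ _ _ _ Gm (fun=> setT) _ _
  (mrestr P mB) (mscale (NngNum PB0) P)) => //.
- by rewrite bigcup_const.
- by move=> E GE; apply: etrans (esym (mPB E)); exact: h.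
- move=> _; change (P (setT `&` B) < +oo); rewrite setTI -ge0_fin_numE//.
  exact: fin_num_measure.
Qed.

Lemma independent_sigma (G1 G2 : set_system T) :
  G1 `<=` measurable -> setI_closed G1 -> G1 setT ->
  G2 `<=` measurable -> setI_closed G2 -> G2 setT ->
  (forall A B, G1 A -> G2 B -> P (A `&` B) = P A * P B) ->
  forall A B, <<s G1 >> A -> <<s G2 >> B -> P (A `&` B) = P A * P B.
Proof.
move=> G1m G1I G1T G2m G2I G2T h A B sA sB.
have sm G : G `<=` measurable -> <<s G >> `<=` @measurable _ T.
  by move=> Gm; apply: smallest_sub => //; exact: sigma_algebra_measurable.
rewrite setIC muleC; apply: independent_one sB => //; first exact: sm sA.
move=> C G2C; rewrite setIC muleC.
by apply: independent_one sA => //; [exact: G2m|move=> D G1D; exact: h].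
Qed.

End PiLambda.

Section IndependentSequence.
Context d (T : measurableType d) (R : realType) (P : probability T R).
Variable X : nat -> 'I_2 -> T -> R.
Hypothesis mX : forall l k, measurable_fun setT (X l k).

(** The events that restrict every coordinate of [X i, ..., X j.-1] separately. *)
Definition box (i j : nat) (A : nat -> 'I_2 -> set R) : set T :=
  [set w | forall l k, (i <= l < j)%N -> A l k (X l k w)].

Hypothesis indep : forall n A, (forall l k, measurable (A l k)) ->
  P (box 0 n A) =
  (\big[*%E/1]_(l < n) \big[*%E/1]_(k < 2) P (X l k @^-1` A l k))%E.

Definition boxes (i j : nat) : set_system T :=
  [set E | exists2 A, (forall l k, measurable (A l k)) & E = box i j A].

Local Notation "'sig' i j" := <<s boxes i j >>
  (at level 10, i at level 9, j at level 9).

Let measurable_cyl l k (B : set R) : measurable B -> measurable (X l k @^-1` B).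
Proof. by move=> mB; rewrite -[X in measurable X]setTI; exact: mX. Qed.

Lemma measurable_box i j A : (forall l k, measurable (A l k)) ->
  measurable (box i j A).
Proof.
move=> mA.
have -> : box i j A = \bigcap_(l in [set l | (i <= l < j)%N])
    \bigcap_(k in [set: 'I_2]) X l k @^-1` A l k.
  apply/seteqP; split => w /= h.
    by move=> l hl k _; exact: h.
  by move=> l k hl; exact: h.
apply: bigcap_measurableType => l _; apply: fin_bigcap_measurable => // k _.
exact: measurable_cyl.
Qed.

Lemma boxes_measurable i j : boxes i j `<=` measurable.
Proof. by move=> _ [A mA ->]; exact: measurable_box. Qed.

Lemma boxesT i j : boxes i j setT.
Proof. by exists (fun _ _ => setT) => //; apply/seteqP; split. Qed.

Lemma boxes_setI i j : setI_closed (boxes i j).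
Proof.
move=> _ _ [A mA ->] [B mB ->]; exists (fun l k => A l k `&` B l k).
  by move=> l k; exact: measurableI.
apply/seteqP; split => w /=.
  by move=> [hA hB] l k h; split; [exact: hA|exact: hB].
by move=> h; split => l k hl; have [] := h l k hl.
Qed.

Lemma boxes_sub i j i' j' : (i' <= i)%N -> (j <= j')%N ->
  boxes i j `<=` boxes i' j'.
Proof.
move=> ii jj _ [A mA ->].
exists (fun l k => if (i <= l < j)%N then A l k else setT).
  by move=> l k; case: ifP.
apply/seteqP; split => w /= h l k hl.
  by case: ifP => // hl'; exact: h.
have := h l k; rewrite hl; apply.
by move/andP: hl => [h1 h2]; rewrite (leq_trans ii)// (leq_trans h2).
Qed.

Lemma sig_sub i j i' j' : (i' <= i)%N -> (j <= j')%N -> sig i j `<=` sig i' j'.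
Proof.
move=> ii jj; apply: smallest_sub; first exact: smallest_sigma_algebra.
by move=> E /(boxes_sub ii jj) GE; exact: sub_sigma_algebra.
Qed.

Lemma sig_measurable i j : sig i j `<=` measurable.
Proof.
apply: smallest_sub; first exact: sigma_algebra_measurable.
exact: boxes_measurable.
Qed.

Lemma prob_box m n A : (m <= n)%N -> (forall l k, measurable (A l k)) ->
  P (box m n A) =
  (\big[*%E/1]_(m <= l < n) \big[*%E/1]_(k < 2) P (X l k @^-1` A l k))%E.
Proof.
move=> mn mA.
pose A' l k := if (m <= l)%N then A l k else setT.
have -> : box m n A = box 0 n A'.
  rewrite /A'; apply/seteqP; split => w /= h l k.
    by move=> hl; case: ifPn => // ml; apply: h; rewrite ml.
  by move=> /andP[ml ln]; have := h l k ln; rewrite ml.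
rewrite indep; last by move=> l k; rewrite /A'; case: ifP.
rewrite -(big_mkord predT
  (fun l => \big[*%E/1]_(k < 2) P (X l k @^-1` A' l k))%E).
rewrite (big_cat_nat (leq0n m) mn)//= big_nat_cond big1 ?mul1e; last first.
  move=> l /andP[/andP[_ lm] _]; apply: big1 => k _.
  by rewrite /A' leqNgt lm/= preimage_setT probability_setT.
rewrite [LHS]big_nat_cond [RHS]big_nat_cond; apply: eq_bigr => l.
by move=> /andP[/andP[ml _] _]; rewrite /A' ml.
Qed.

(** Boxes of past and of future increments are independent since their
intersection is a box again. *)
Lemma independent_past_future m n A B : (m <= n)%N ->
  sig 0 m A -> sig m n B -> P (A `&` B) = (P A * P B)%E.
Proof.
move=> mn; apply: independent_sigma.
- exact: boxes_measurable.
- exact: boxes_setI.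
- exact: boxesT.
- exact: boxes_measurable.
- exact: boxes_setI.
- exact: boxesT.
move=> _ _ [E mE ->] [F mF ->].
pose C l k := if (l < m)%N then E l k else F l k.
have mC l k : measurable (C l k) by rewrite /C; case: ifP.
have -> : box 0 m E `&` box m n F = box 0 n C.
  rewrite /C; apply/seteqP; split => w /=.
    move=> [hE hF] l k ln; case: ltnP => lm; first exact: hE.
    by apply: hF; rewrite lm.
  move=> h; split => l k.
    by move=> /andP[_ lm]; have := h l k (leq_trans lm mn); rewrite lm.
  by move=> /andP[ml ln]; have := h l k ln; rewrite ltnNge ml.
rewrite !prob_box// (big_cat_nat (leq0n m) mn)//=; congr (_ * _)%E.
  rewrite [LHS]big_nat_cond [RHS]big_nat_cond; apply: eq_bigr => l.
  by move=> /andP[/andP[_ lm] _]; rewrite /C lm.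
rewrite [LHS]big_nat_cond [RHS]big_nat_cond; apply: eq_bigr => l.
by move=> /andP[/andP[ml _] _]; rewrite /C ltnNge ml.
Qed.

Lemma sig_increment i j l k (B : set R) : (i <= l < j)%N -> measurable B ->
  sig i j (X l k @^-1` B).
Proof.
move=> hl mB; apply: sub_sigma_algebra.
exists (fun l' k' => if (l' == l) && (k' == k) then B else setT).
  by move=> l' k'; case: ifP.
apply/seteqP; split => w /=.
  by move=> h l' k' _; case: ifP => // /andP[/eqP-> /eqP->].
by move=> /(_ l k hl); rewrite !eqxx.
Qed.

Lemma sig_sum i j m n k (B : set R) : (i <= m)%N -> (n <= j)%N -> measurable B ->
  sig i j [set w | B (\sum_(m <= l < n) X l k w)].
Proof.
move=> im nj mB.
pose S : measurableType _ := g_sigma_algebraType (boxes i j).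
have mXS l : (m <= l < n)%N -> measurable_fun [set: S] (X l k : S -> R).
  move=> /andP[ml ln] _ C mC; rewrite setTI; apply: sig_increment => //.
  by rewrite (leq_trans im)// (leq_trans ln).
have : measurable_fun [set: S] (fun w : S => \sum_(m <= l < n) X l k w).
  elim: n nj mXS => [|n IH] nj mXS.
    by under eq_fun do rewrite big_geq//; exact: measurable_cst.
  have [mn|nm] := leqP m n; last first.
    by under eq_fun do rewrite big_geq//; exact: measurable_cst.
  under eq_fun do rewrite big_nat_recr//=.
  apply: measurable_funD; last by apply: mXS; rewrite mn /=.
  apply: IH => [|l /andP[ml ln]]; first exact: ltnW.
  by apply: mXS; rewrite ml (ltn_trans ln).
by move=> /(_ measurableT B mB); rewrite setTI.
Qed.

Let sigI i j (A B : set T) : sig i j A -> sig i j B -> sig i j (A `&` B).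
Proof. exact: (@measurableI _ (g_sigma_algebraType (boxes i j))). Qed.

Let sigU i j (A B : set T) : sig i j A -> sig i j B -> sig i j (A `|` B).
Proof. exact: (@measurableU _ (g_sigma_algebraType (boxes i j))). Qed.

Let sigD i j (A B : set T) : sig i j A -> sig i j B -> sig i j (A `\` B).
Proof. exact: (@measurableD _ (g_sigma_algebraType (boxes i j))). Qed.

Let measurable_le (x : R) : measurable [set y : R | `|y| <= x].
Proof.
rewrite (_ : mkset _ = `[- x, x]%classic); first exact: measurable_itv.
by apply/seteqP; split=> y /=; rewrite in_itv/= ler_norml.
Qed.

(** Split according to the first index at which the partial sum exceeds [2 x].
From there on the rest of the sum is independent of the past and at most [x]
with probability one half, and then the whole sum exceeds [x]. *)
Lemma ottaviani n k (x : R) : 0 <= x ->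
  (forall j, (j <= n)%N ->
    ((1 / 2)%:E <= P [set w | (`|\sum_(j <= l < n) X l k w| <= x)%R])%E) ->
  (P [set w | exists2 j, (j <= n)%N & (2 * x < `|\sum_(0 <= l < j) X l k w|)%R]
   <= 2%:E * P [set w | (x < `|\sum_(0 <= l < n) X l k w|)%R])%E.
Proof.
move=> x0 half.
pose B m : set T :=
  [set w | exists2 j, (j <= m)%N & 2 * x < `|\sum_(0 <= l < j) X l k w|].
set C := [set w | x < _].
have mC : measurable C.
  apply: (@sig_measurable 0 n).
  exact: (@sig_sum 0 n 0 n k _ (leqnn _) (leqnn _) (measurable_normr_gt x)).
suff main m : (m <= n)%N ->
    sig 0 m (B m) /\ ((1 / 2)%:E * P (B m) <= P (B m `&` C))%E.
  have [sB hB] := main n (leqnn _); rewrite -/(B n).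
  have mB : measurable (B n) by exact: sig_measurable sB.
  have -> : P (B n) = (2%:E * ((1 / 2)%:E * P (B n)))%E.
    by rewrite muleA -EFinM (_ : 2 * _ = 1) ?mul1e//; field.
  rewrite lee_wpmul2l// (le_trans hB)// le_measure ?inE//.
  by apply: measurableI.
elim: m => [|m IH] mn.
  have -> : B 0%N = set0.
    apply/seteqP; split => w //= [j]; rewrite leqn0 => /eqP ->.
    by rewrite big_geq// normr0 ltNge mulr_ge0.
  rewrite set0I measure0 mule0; split => //.
  exact: (@measurable0 _ (g_sigma_algebraType (boxes 0 0))).
have [sB hB] := IH (ltnW mn).
pose D : set T := [set w | 2 * x < `|\sum_(0 <= l < m.+1) X l k w|].
have sD : sig 0 m.+1 D.
  exact: (@sig_sum 0 m.+1 0 m.+1 k _ (leqnn _) (leqnn _) (measurable_normr_gt _)).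
have sB' : sig 0 m.+1 (B m) by exact: (sig_sub (leqnn _) (leqnSn _)) sB.
have BS : B m.+1 = B m `|` (D `\` B m).
  apply/seteqP; split => w /=.
    have [Bw|nBw] := pselect (B m w); first by left.
    move=> [j]; rewrite leq_eqVlt => /orP[/eqP ->|jm] h; first by right.
    by case: nBw; exists j.
  by move=> [[j jm h]|[h _]]; [exists j => //; exact: leqW|exists m.+1].
split; first by rewrite BS; apply: sigU => //; exact: sigD.
set F := D `\` B m in BS.
have sF : sig 0 m.+1 F by exact: sigD.
have mF : measurable F by exact: sig_measurable sF.
have mB : measurable (B m) by exact: sig_measurable sB.
have disj : B m `&` F = set0 by apply/seteqP; split => // w [? []].
have hF : ((1 / 2)%:E * P F <= P (F `&` C))%E.
  (* the rest of the sum is small *)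
  pose K : set T := [set w | `|\sum_(m.+1 <= l < n) X l k w| <= x].
  have sK : sig m.+1 n K.
    exact: (@sig_sum m.+1 n m.+1 n k _ (leqnn _) (leqnn _) (measurable_le x)).
  have mK : measurable K by exact: sig_measurable sK.
  apply: (@le_trans _ _ (P (F `&` K))).
    by rewrite (independent_past_future mn sF sK) muleC lee_wpmul2l// half.
  rewrite le_measure ?inE//; [exact: measurableI|exact: measurableI|].
  move=> w [[Dw Bw] Kw]; split => //; rewrite /C /=.
  rewrite (big_cat_nat (leq0n m.+1) mn)//=.
  move: Dw Kw; rewrite /D /K /=.
  set u := \sum_(0 <= l < m.+1) _; set v := \sum_(m.+1 <= l < n) _ => h1 h2.
  have := ler_normB (u + v) v; rewrite addrK; lra.
rewrite BS setIUl !measureU//; last 3 first.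
- exact: measurableI.
- exact: measurableI.
- by rewrite -setIIl disj set0I.
by rewrite muleDr ?ge0_adde_def ?inE// leeD.
Qed.

(** By induction: the first blocks belong to the past of the next one. *)
Lemma block_product (M N : nat) (q : R) (E : nat -> set T) : 0 <= q ->
  (forall i, (i < N)%N -> sig (i * M) (i.+1 * M) (E i)) ->
  (forall i, (i < N)%N -> (q%:E <= P (E i))%E) ->
  ((q ^+ N)%:E <= P [set w | forall i, (i < N)%N -> E i w])%E.
Proof.
move=> q0 sE hE.
suff main n : (n <= N)%N ->
  sig 0 (n * M) [set w | forall i, (i < n)%N -> E i w] /\
  ((q ^+ n)%:E <= P [set w | forall i, (i < n)%N -> E i w])%E.
  by have [] := main N (leqnn _).
elim: n => [|n IH] nN.
  rewrite (_ : mkset _ = setT); last by apply/seteqP.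
  rewrite probability_setT expr0; split => //.
  exact: (@measurableT _ (g_sigma_algebraType (boxes 0 (0 * M)))).
have [s1 h1] := IH (ltnW nN).
have -> : [set w | forall i, (i < n.+1)%N -> E i w] =
    [set w | forall i, (i < n)%N -> E i w] `&` E n.
  apply/seteqP; split => w /=.
    by move=> h; split => [i hi|]; apply: h => //; exact: ltnW.
  by move=> [h hn] i; rewrite ltnS leq_eqVlt => /orP[/eqP->//|]; exact: h.
have le1 : (n * M <= n.+1 * M)%N by rewrite leq_mul2r leqnSn orbT.
split.
  apply: sigI; first exact: (sig_sub (leqnn _) le1) s1.
  exact: (sig_sub (leq0n _) (leqnn _)) (sE _ nN).
rewrite (independent_past_future le1 s1 (sE _ nN)) exprSr EFinM.
by rewrite lee_pmul ?lee_fin ?exprn_ge0// hE.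
Qed.

End IndependentSequence.

(** * Choice of the mesh *)

Section Mesh.
Variable R : realType.

(** Covering argument: the modulus of continuity at one point serves its
neighbours, and finitely many points serve the compact interval. *)
Lemma heine_cantor (f : R -> R) (T e : R) : {within `[0, T], continuous f} ->
  0 < e -> exists2 dl : R, 0 < dl & forall s r, s \in `[0, T] -> r \in `[0, T] ->
    `|s - r| <= dl -> `|f s - f r| <= e.
Proof.
move=> cf e0.
pose Q (dl s : R) := s \in `[0, T] -> forall r, r \in `[0, T] ->
  `|s - r| <= dl -> `|f s - f r| <= e.
have /compact_near_coveringP cov := @segment_compact R 0 T.
have : \forall dl \near 0^'+, `[0, T] `<=` Q dl.
  apply: cov => s sT.
  move/subspace_continuousP : cf => /(_ s sT)/cvgrPdist_le/(_ (e / 2)).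
  rewrite divr_gt0// => /(_ isT); rewrite near_withinE.
  move=> /nbhs_ballP[/= eta eta0 h].
  have h' r : r \in `[0, T] -> `|s - r| < eta -> `|f s - f r| <= e / 2.
    by move=> rT sr; exact: (h r sr rT).
  have e2 : 0 < eta / 2 by rewrite divr_gt0.
  near=> s' dl => /= s'T r rT s'r.
  have d1 : `|s - s'| < eta / 2.
    by near: s'; exact: (nbhsx_ballx s _ e2).
  have d2 : dl < eta / 2 by near: dl; exact: nbhs_right_lt.
  have d3 : `|s - s'| < eta by lra.
  have i1 := h' s' s'T d3.
  have sr : `|s - r| < eta.
    by have := ler_distD s' s r; lra.
  have i2 := h' r rT sr.
  have := ler_distD (f s) (f s') (f r); rewrite (distrC (f s') (f s)); lra.
move=> cl; near (0 : R)^'+ => dl.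
exists dl => // s r sT rT sr.
have : `[0, T] `<=` Q dl by near: dl.
by move=> /(_ s sT sT r rT sr).
Unshelve. all: by end_near. Qed.

Lemma expR_gt_sqr (y : R) : 0 <= y -> y ^+ 2 / 4 < expR y.
Proof.
move=> y0; have h := expR_ge1Dx (y / 2).
have -> : expR y = expR (y / 2) ^+ 2.
  by rewrite expr2 -expRD; congr expR; field.
nra.
Qed.

(** The bound of [normal_tail] for an increment over a time [tau]. *)
Definition tail_bound (x tau : R) : R := Num.sqrt 2 * expR (- (x ^+ 2 / (4 * tau))).

(** The bound of [normal_ball_ge] for a window of radius [h] within [[- k, k]]
and an increment over a time [tau]. *)
Definition ball_bound (h k tau : R) : R :=
  2 * h * normal_peak (Num.sqrt tau) * expR (- (k ^+ 2 / (2 * tau))).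

(** Both sides of the last inequality decay exponentially in [N], but the window
[[- e / 24, e / 24]] costs less than leaving [[- e / 8, e / 8]], even after the
lower bound is squared (once for each coordinate); the prefactor is only of
order [1 / N]. *)
Lemma fine_mesh (e T dl : R) : 0 < e -> 0 < T -> 0 < dl ->
  exists2 N : nat, (0 < N)%N & let tau := T / N%:R in
  [/\ tau <= dl, tail_bound (e / 8) tau <= 1 / 2 &
      4 * tail_bound (e / 8) tau < ball_bound (e / (48 * N%:R)) (e / 24) tau ^+ 2].
Proof.
move=> e0 T0 dl0.
pose kap := e ^+ 2 / T; have kap0 : 0 < kap by rewrite divr_gt0 ?exprn_gt0.
pose c := 5 * kap / 48 ^+ 2; have c0 : 0 < c by rewrite /c; lra.
have [p pE p0] : exists2 p : R, p = pi & 0 < p by exists pi; [|exact: pi_gt0].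
(* [n > B] makes [exp (c n) > (c n)^2 / 4] beat the ratio of the prefactors *)
pose B := (4 * 48) ^+ 2 * (p / kap) / c ^+ 2.
have pk0 : 0 < p / kap by exact: divr_gt0.
have B0 : 0 < B.
  by rewrite /B; apply: divr_gt0; [lra|exact: exprn_gt0].
pose x := T / dl + (3 * 16 ^+ 2) / kap + B.
have Td0 : 0 < T / dl by rewrite divr_gt0.
have k0 : 0 < (3 * 16 ^+ 2) / kap by apply: divr_gt0; [lra|exact: kap0].
pose N := (Num.trunc x).+1; have xN : x < N%:R by exact: truncnS_gt.
exists N => //=; set n : R := N%:R in xN *.
have n0 : 0 < n by rewrite ltr0n.
have tau0 : 0 < T / n by rewrite divr_gt0.
have s2 : Num.sqrt 2 <= 2 :> R.
  by rewrite -(@ler_pXn2r _ 2)// ?nnegrE// ?sqrtr_ge0// sqr_sqrtr//; lra.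
have tailE : tail_bound (e / 8) (T / n) = Num.sqrt 2 * expR (- (kap * n / 16 ^+ 2)).
  rewrite /tail_bound /kap; congr (_ * expR (- _)).
  by field; rewrite !gt_eqF.
have ballE : ball_bound (e / (48 * n)) (e / 24) (T / n) ^+ 2 =
    kap / ((2 * 24 ^+ 2) * p * n) * expR (- (kap * n / 24 ^+ 2)).
  rewrite /ball_bound /normal_peak -pE sqr_sqrtr; last exact: ltW.
  have peak2 : (Num.sqrt (T / n * p *+ 2))^-1 ^+ 2 = (T / n * p *+ 2)^-1.
    by rewrite exprVn sqr_sqrtr// mulrn_wge0// mulr_ge0// ltW.
  rewrite 2!(exprMn 2) peak2.
  have -> : expR (- ((e / 24) ^+ 2 / (2 * (T / n)))) ^+ 2
      = expR (- (kap * n / 24 ^+ 2)).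
    rewrite expr2 -expRD; congr expR; rewrite /kap.
    by field; rewrite !gt_eqF.
  congr (_ * _); rewrite /kap; field.
  by rewrite !gt_eqF.
split.
- rewrite ler_pdivrMr// mulrC -ler_pdivrMr//.
  by apply: ltW; apply: le_lt_trans xN; rewrite /x -addrA lerDl addr_ge0 ?ltW.
- rewrite tailE expRN.
  have y0 : (3 * 16 ^+ 2) / kap <= n.
    by apply: ltW; apply: le_lt_trans xN; rewrite /x; lra.
  rewrite ler_pdivrMr// in y0.
  have E4 : 4 <= expR (kap * n / 16 ^+ 2).
    by apply: le_trans (expR_ge1Dx _); lra.
  rewrite ler_pdivrMr; last by rewrite expR_gt0.
  lra.
- rewrite tailE ballE.
  (* 1 / 16^2 - 1 / 24^2 = 5 / 48^2 is the gain in the exponent *)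
  have -> : - (kap * n / 16 ^+ 2) = - (kap * n / 24 ^+ 2) + - (c * n).
    by rewrite /c; field.
  rewrite expRD.
  have E5 := expR_gt0 (- (kap * n / 24 ^+ 2)).
  rewrite mulrA mulrCA (mulrC (kap / _)) ltr_pM2l//.
  have cn0 : 0 <= c * n by rewrite mulr_ge0 ?ltW.
  have E6 := expR_gt_sqr cn0.
  rewrite expRN -/(_ / _).
  rewrite ltr_pdivrMr ?expR_gt0//.
  have nB : B < n by apply: le_lt_trans xN; rewrite /x; lra.
  have pn0 : 0 < p * n by exact: mulr_gt0.
  have kd : 0 < kap / ((2 * 24 ^+ 2) * p * n).
    by apply: divr_gt0; [exact: kap0|lra].
  apply: le_lt_trans (ler_wpM2l _ s2) _ => //.
  apply: lt_trans (_ : kap / ((2 * 24 ^+ 2) * p * n) * ((c * n) ^+ 2 / 4) < _);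
    last first.
    by rewrite ltr_pM2l.
  have -> : kap / ((2 * 24 ^+ 2) * p * n) * ((c * n) ^+ 2 / 4) = 8 * (n / B).
    by rewrite /B; field; rewrite !gt_eqF.
  rewrite (_ : 4 * 2 = 8 * 1); last by ring.
  by rewrite ltr_pM2l// ltr_pdivlMr// mul1r.
Qed.

End Mesh.

(** * Increments of Wiener paths *)

Section WienerTube.
Variable R : realType.

Lemma W_continuous (w : wiener_space R) (k : 'I_2) : continuous (fun t => W t w k 0).
Proof.
move=> t; have [cw _] : [set w | continuous (w : R -> 'cV[R]_2) /\ w 0 = 0]
    (\val (w : path_space R)) by exact: set_valP.
apply: (@continuous_comp _ _ _ (fun t => W t w) (fun v : 'cV[R]_2 => v k 0)).
  exact: cw.
exact: coord_continuous.
Qed.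

Lemma W_at0 (w : wiener_space R) : W 0 w = 0.
Proof.
by have [_ w0] : [set w | continuous (w : R -> 'cV[R]_2) /\ w 0 = 0]
    (\val (w : path_space R)) by exact: set_valP.
Qed.

(** Evaluation at [t] is continuous for the compact-open topology, since one
point is a compact set. *)
Lemma measurable_W (t : R) (k : 'I_2) :
  measurable_fun [set: wiener_space R] (fun w : wiener_space R => W t w k 0).
Proof.
apply: (measurability _ (RGenOInfty.measurableE R)) => _ [_ [x ->] <-].
rewrite setTI; apply: sub_sigma_algebra.
pose O := (fun v : 'cV[R]_2 => v k 0) @^-1` `]x, +oo[.
have oO : open O.
  apply: open_comp; last exact: interval_open.
  by move=> v _; exact: coord_continuous.
have oK := @compact_open_open R 'cV[R]_2 [set t] O (@compact_set1 R t) oO.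
have val_cont : continuous
    (\val : path_space R -> {compact-open, R -> 'cV[R]_2}).
  exact: initial_continuous.
rewrite (_ : (fun w => _) @^-1` _ = \val @^-1` [set g | g @` [set t] `<=` O]).
  by apply: open_comp oK => w _; exact: val_cont.
apply/seteqP; split => w /=.
  by move=> h _ [_ -> <-].
by move=> h; apply: h; exists t.
Qed.

Variable P : probability (wiener_space R) R.
Hypothesis hP : two_sided_wiener P.

Definition Winc (k : 'I_2) (s t : R) (w : wiener_space R) : R := (W t w - W s w) k 0.

Lemma WincE k s t w : Winc k s t w = W t w k 0 - W s w k 0.
Proof. by rewrite /Winc !mxE. Qed.

Lemma measurable_Winc k s t : measurable_fun [set: wiener_space R] (Winc k s t).
Proof.
rewrite (_ : Winc k s t = fun w => W t w k 0 - W s w k 0); last first.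
  by apply/funext => w; rewrite WincE.
by apply: measurable_funB; exact: measurable_W.
Qed.

Lemma Winc_independent (tau : nat -> R) : {homo tau : i j / (i < j)%N >-> i < j} ->
  forall n A, (forall l k, measurable (A l k)) ->
  P (box (fun l k => Winc k (tau l) (tau l.+1)) 0 n A) =
  (\big[*%E/1]_(l < n) \big[*%E/1]_(k < 2)
     P (Winc k (tau l) (tau l.+1) @^-1` A l k))%E.
Proof.
move=> htau n A mA.
rewrite -(wiener_independent hP htau (A := fun (i : 'I_n) k => A i k))//.
congr (P _); apply/seteqP; split => w /= h.
  by move=> i k; apply: h => /=.
by move=> l k ln; exact: (h (Ordinal ln) k).
Qed.

Lemma sum_Winc (tau : nat -> R) k m n w : (m <= n)%N ->
  \sum_(m <= l < n) Winc k (tau l) (tau l.+1) w = Winc k (tau m) (tau n) w.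
Proof.
move=> mn; under eq_bigr do rewrite WincE.
by rewrite (telescope_sumr (fun l => W (tau l) w k 0))// WincE.
Qed.

Lemma Winc_tail k s t (x tau : R) : s < t -> t - s <= tau -> 0 <= x ->
  (P [set w | (x < `|Winc k s t w|)%R] <= (tail_bound x tau)%:E)%E.
Proof.
move=> st sttau x0.
rewrite (wiener_gaussian hP k (A := [set y | x < `|y|]))//; last first.
  exact: measurable_normr_gt.
have ts : 0 < t - s by rewrite subr_gt0.
apply: le_trans (normal_tail _ _) _ => //; first by rewrite sqrtr_gt0.
rewrite lee_fin /tail_bound ler_wpM2l ?sqrtr_ge0// ler_expR lerN2.
rewrite sqr_sqrtr; last exact: ltW.
rewrite ler_wpM2l ?sqr_ge0// lef_pV2 ?posrE ?mulr_gt0//.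
  by rewrite ler_pM2l.
exact: lt_le_trans sttau.
Qed.

Lemma Winc_concentrated k s t (x tau : R) : s <= t -> t - s <= tau -> 0 <= x ->
  tail_bound x tau <= 1 / 2 ->
  ((1 / 2)%:E <= P [set w | (`|Winc k s t w| <= x)%R])%E.
Proof.
move=> st sttau x0 half.
have [<-|st'] := eqVneq s t.
  rewrite (_ : mkset _ = setT).
    by rewrite probability_setT lee_fin; lra.
  by apply/seteqP; split => w //= _; rewrite WincE subrr normr0.
have mC : measurable [set w | x < `|Winc k s t w|].
  rewrite -[X in measurable X]setTI.
  exact: (@measurable_Winc k s t measurableT _ (measurable_normr_gt x)).
rewrite (_ : mkset _ = ~` [set w | x < `|Winc k s t w|]); last first.
  by apply/seteqP; split=> w /= => [/le_gtF->//|/negP]; rewrite -leNgt.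
rewrite probability_setC//.
have st1 : s < t by rewrite lt_neqAle st' st.
have h := Winc_tail k st1 sttau x0.
have f : P [set w | x < `|Winc k s t w|] \is a fin_num by exact: fin_num_measure.
move: h; rewrite -(fineK f) -EFinB !lee_fin; lra.
Qed.

(** [ottaviani] on a regular grid; the bound does not depend on the number [M] of
grid points. *)
Lemma Winc_maximal k s (x tau : R) M : 0 < tau -> (0 < M)%N -> 0 <= x ->
  tail_bound x tau <= 1 / 2 ->
  (P [set w | exists2 j, (j <= M)%N &
      (2 * x < `|Winc k s (s + j%:R * (tau / M%:R)) w|)%R]
   <= (2 * tail_bound x tau)%:E)%E.
Proof.
move=> tau0 M0 x0 half.
have M0' : 0 < M%:R :> R by rewrite ltr0n.
pose de := tau / M%:R; have de0 : 0 < de by rewrite divr_gt0.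
pose t (j : nat) : R := s + j%:R * de.
have ht : {homo t : i j / (i < j)%N >-> i < j}.
  by move=> i j ij; rewrite /t ltrD2l ltr_pM2r// ltr_nat.
have t0 : t 0%N = s by rewrite /t mul0r addr0.
have tM : t M = s + tau by rewrite /t /de mulrC divfK// gt_eqF.
have tle i j : (i <= j)%N -> t i <= t j.
  by move=> ij; rewrite /t lerD2l ler_pM2r// ler_nat.
have mX l k' : measurable_fun setT (Winc k' (t l) (t l.+1)).
  exact: measurable_Winc.
have := @ottaviani _ _ _ P (fun l k => Winc k (t l) (t l.+1)) mX (Winc_independent ht)
  M k x x0.
have half' j : (j <= M)%N ->
  ((1 / 2)%:E <= P [set w | (`|\sum_(j <= l < M) Winc k (t l) (t l.+1) w| <= x)%R])%E.
  move=> jM; under [X in P X]eq_set do rewrite sum_Winc//.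
  apply: (@Winc_concentrated _ _ _ _ tau) => //; first exact: tle.
  by rewrite tM; have := tle _ _ (leq0n j); rewrite t0; lra.
move=> /(_ half').
rewrite (_ : mkset _ = [set w | exists2 j, (j <= M)%N &
    2 * x < `|Winc k s (s + j%:R * (tau / M%:R)) w|]); last first.
  apply/seteqP; split => w /= [j jM hj]; exists j => //; move: hj.
    by rewrite sum_Winc// t0.
  by rewrite sum_Winc// t0.
move=> h; apply: le_trans h _.
rewrite EFinM lee_wpmul2l//.
under [X in P X]eq_set do rewrite sum_Winc//.
rewrite t0 tM; apply: Winc_tail => //; first by rewrite ltrDl.
by rewrite addrAC subrr add0r.
Qed.

End WienerTube.

(** * Wiener measure charges tubes *)

Section TubePositive.
Variables (R : realType) (P : probability (wiener_space R) R).
Hypothesis hP : two_sided_wiener P.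

Section Block.
Variables (tau eta x k0 : R) (c : 'I_2 -> R) (i n : nat).
Hypotheses (tau0 : 0 < tau) (eta0 : 0 < eta) (x0 : 0 <= x).

Let s : R := i%:R * tau.
Let s' : R := i.+1%:R * tau.
Let M := (2 ^ n)%N.
Let de : R := tau / M%:R.
Let M0 : (0 < M)%N. Proof. by rewrite expn_gt0. Qed.
Let de0 : 0 < de. Proof. by rewrite divr_gt0// ltr0n. Qed.

(** Good behaviour in the time interval [[i tau, (i + 1) tau]]: the increment is
close to the prescribed one, and the oscillation on the dyadic grid of level
[n] is small. *)
Definition block : set (wiener_space R) :=
  [set w | (forall k, `|Winc k s s' w - c k| <= eta) /\
    forall k j, (j <= M)%N -> `|Winc k s (s + j%:R * de) w| <= 2 * x].

Let t (l : nat) : R := l%:R * de.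

Let t_block j : t (i * M + j)%N = s + j%:R * de.
Proof.
rewrite /t natrD mulrDl natrM -mulrA (mulrC M%:R) /de divfK//.
by rewrite pnatr_eq0 -lt0n.
Qed.

Let t_start : t (i * M)%N = s.
Proof. by rewrite -[X in t X]addn0 t_block mul0r addr0. Qed.

Let t_end : t (i.+1 * M)%N = s'.
Proof.
rewrite /t natrM -mulrA (mulrC M%:R) /de divfK//.
by rewrite pnatr_eq0 -lt0n.
Qed.

Let measurable_ball_le (r : R) (y0 : R) : measurable [set y : R | `|y - y0| <= r].
Proof. by rewrite ball_itvE; exact: measurable_itv. Qed.

(** A block is an event of the increments on its own part of the dyadic grid,
hence independent of the other blocks. *)
Lemma block_sig : <<s boxes (fun l k => Winc k (t l) (t l.+1)) (i * M) (i.+1 * M) >>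
  block.
Proof.
pose S := g_sigma_algebraType
  (boxes (fun l k => Winc k (t l) (t l.+1)) (i * M) (i.+1 * M)).
have mX l k : measurable_fun setT (Winc k (t l) (t l.+1)).
  exact: measurable_Winc.
have iM : (i * M <= i.+1 * M)%N by rewrite leq_mul2r leqnSn orbT.
pose F k : set (wiener_space R) := [set w | `|Winc k s s' w - c k| <= eta].
have mF k : measurable (F k : set S).
  have := @sig_sum _ _ _ (fun l k => Winc k (t l) (t l.+1)) (i * M) (i.+1 * M)
    (i * M) (i.+1 * M) k _ (leqnn _) (leqnn _) (measurable_ball_le eta (c k)).
  rewrite (_ : mkset _ = F k)//.
  by apply/seteqP; split=> w; rewrite /F /= sum_Winc// t_start t_end.
pose G k j : set (wiener_space R) :=
  [set w | (j <= M)%N -> `|Winc k s (s + j%:R * de) w| <= 2 * x].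
have mG k j : measurable (G k j : set S).
  have [jM|jM] := leqP j M; last first.
    rewrite (_ : G k j = setT); first exact: measurableT.
    by apply/seteqP; split=> w //= _; rewrite /G /= leqNgt jM.
  have ijM : (i * M + j <= i.+1 * M)%N by rewrite mulSn addnC leq_add2r.
  have := @sig_sum _ _ _ (fun l k => Winc k (t l) (t l.+1)) (i * M) (i.+1 * M)
    (i * M) (i * M + j) k _ (leqnn _) ijM (measurable_ball_le (2 * x) 0).
  rewrite (_ : mkset _ = G k j)//.
  apply/seteqP; split=> w; rewrite /G /= sum_Winc ?leq_addr//.
    by rewrite t_start t_block subr0.
  by rewrite t_start t_block subr0; apply.
rewrite (_ : block = (\bigcap_(k in [set: 'I_2]) F k) `&`
  (\bigcap_(k in [set: 'I_2]) \bigcap_j G k j)); last first.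
  apply/seteqP; split => w /=.
    by move=> [h1 h2]; split => [k _|k _ j _]; [exact: h1|exact: h2].
  by move=> [h1 h2]; split => [k|k j]; [exact: h1|exact: h2].
apply: (@measurableI _ S).
  by apply: (@fin_bigcap_measurable _ S) => // k _.
apply: (@fin_bigcap_measurable _ S) => // k _.
exact: (@bigcap_measurableType _ S).
Qed.

Hypotheses (tail_half : tail_bound x tau <= 1 / 2)
  (c_small : forall k, `|c k| + eta <= k0).

(** The two coordinates of the increment are independent, which gives the square;
each of the two oscillations fails with probability at most [2 tail_bound]. *)
Lemma block_prob :
  ((ball_bound eta k0 tau ^+ 2 - 4 * tail_bound x tau)%:E <= P block)%E.
Proof.
pose A : set (wiener_space R) := [set w | forall k, `|Winc k s s' w - c k| <= eta].
pose B k : set (wiener_space R) :=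
  [set w | exists2 j, (j <= M)%N & 2 * x < `|Winc k s (s + j%:R * de) w|].
pose u (l : nat) : R := l%:R * tau.
have hu : {homo u : l m / (l < m)%N >-> l < m}.
  by move=> l m lm; rewrite /u ltr_pM2r// ltr_nat.
have mX l k : measurable_fun setT (Winc k (u l) (u l.+1)).
  exact: measurable_Winc.
have mC (l : nat) k : measurable [set y : R | `|y - c k| <= eta].
  exact: measurable_ball_le.
have AE : A = box (fun l k => Winc k (u l) (u l.+1)) i i.+1
    (fun _ k => [set y | `|y - c k| <= eta]).
  apply/seteqP; split => w /=.
    move=> h l k; rewrite ltnS -eqn_leq => /eqP <-; exact: h.
  by move=> h k; apply: (h i k); rewrite leqnn ltnSn.
have mA : measurable A by rewrite AE; exact: measurable_box.
have PA : ((ball_bound eta k0 tau ^+ 2)%:E <= P A)%E.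
  rewrite AE (prob_box (Winc_independent hP hu))// big_nat1.
  have each k : ((ball_bound eta k0 tau)%:E <=
      P (Winc k (u i) (u i.+1) @^-1` [set y | (`|y - c k| <= eta)%R]))%E.
    have ui : u i < u i.+1 by exact: hu.
    have := wiener_gaussian hP k ui (mC i k).
    rewrite /preimage /Winc /= => ->.
    have -> : u i.+1 - u i = tau by rewrite /u -mulrBl -natrB// subSnn mul1r.
    have st0 : 0 < Num.sqrt tau by rewrite sqrtr_gt0.
    have := normal_ball_ge st0 eta0 (c_small k).
    by rewrite sqr_sqrtr; last exact: ltW.
  rewrite big_ord_recl big_ord1 expr2 EFinM.
  have b0 : 0 <= ball_bound eta k0 tau.
    rewrite /ball_bound !mulr_ge0 ?expR_ge0 ?normal_peak_ge0//.
    exact: ltW.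
  by apply: lee_pmul => //; rewrite lee_fin.
have mB k : measurable (B k).
  rewrite (_ : B k = \bigcup_(j in [set j | (j <= M)%N])
    (Winc k s (s + j%:R * de) @^-1` [set y | 2 * x < `|y|])).
    apply: bigcup_measurable => j _.
    rewrite -[X in measurable X]setTI.
    exact: (@measurable_Winc _ k _ _ measurableT _ (measurable_normr_gt _)).
  by apply/seteqP; split => w /= [j jM h]; exists j.
have PB k : (P (B k) <= (2 * tail_bound x tau)%:E)%E.
  exact: (Winc_maximal hP k s tau0 M0 x0 tail_half).
have -> : block = A `\` (B 0 `|` B 1).
  apply/seteqP; split => w /=.
    move=> [h1 h2]; split => //.
    by case=> -[j jM]; apply/negP; rewrite -leNgt; exact: h2.
  move=> [h1 /not_orP[h2 h3]]; split => // k j jM.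
  rewrite leNgt; apply/negP => h4.
  by case: (ord2P k) h4 => -> h4; [apply: h2|apply: h3]; exists j.
have PU : (P (B 0%R `|` B 1%R) <= (4 * tail_bound x tau)%:E)%E.
  apply: le_trans (measureU2 _ (mB 0) (mB 1)) _.
  have -> : 4 * tail_bound x tau = 2 * tail_bound x tau + 2 * tail_bound x tau.
    by ring.
  by rewrite EFinD; apply: leeD; exact: PB.
have mU : measurable (B 0 `|` B 1) by exact: measurableU.
rewrite measureD//; last by rewrite -ge0_fin_numE//; exact: fin_num_measure.
have PI : (P (A `&` (B 0%R `|` B 1%R)) <= P (B 0%R `|` B 1%R))%E.
  rewrite le_measure ?inE//; exact: measurableI.
rewrite EFinB; apply: leeB => //.
exact: le_trans PI PU.
Qed.

End Block.

Lemma grid_cell (r s : R) : 0 < r -> 0 <= s ->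
  exists2 i : nat, i%:R * r <= s & s < i%:R * r + r.
Proof.
move=> r0 s0; have sr0 : 0 <= s / r by rewrite divr_ge0// ltW.
have /andP[h1 h2] := truncn_itv sr0; exists (Num.trunc (s / r)).
  by rewrite -ler_pdivlMr.
by rewrite -[X in _ + X]mul1r -mulrDl natr1 -ltr_pdivrMr.
Qed.

Section Path.
Variables (T e dl : R) (h : 'I_2 -> R -> R) (N : nat).
Hypotheses (T0 : 0 < T) (e0 : 0 < e) (N0 : (0 < N)%N).
Hypothesis h0 : forall k, h k 0 = 0.
Hypothesis hdl : forall k (s r : R), s \in `[0, T] -> r \in `[0, T] ->
  `|s - r| <= dl -> `|h k s - h k r| <= e / 48.
Let tau := T / N%:R.
Hypothesis tau_dl : tau <= dl.
Let eta := e / (48 * N%:R).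
Let c (i : nat) k := h k (i.+1%:R * tau) - h k (i%:R * tau).
Let A n := [set w | forall i, (i < N)%N -> block tau eta (e / 8) (c i) i n w].

Let N0' : 0 < N%:R :> R. Proof. by rewrite ltr0n. Qed.
Let tau0 : 0 < tau. Proof. exact: divr_gt0. Qed.
Let eta0 : 0 < eta. Proof. by rewrite divr_gt0// mulr_gt0. Qed.

Lemma mesh_in i : (i <= N)%N -> i%:R * tau \in `[0, T].
Proof.
move=> iN; rewrite in_itv/=; apply/andP; split.
  by rewrite mulr_ge0// ltW.
by rewrite /tau mulrA ler_pdivrMr// mulrC ler_pM2l// ler_nat.
Qed.

Lemma step_small i k : (i < N)%N -> `|c i k| + eta <= e / 24.
Proof.
move=> iN; have : `|c i k| <= e / 48.
  apply: hdl; [exact: mesh_in|exact: (mesh_in (ltnW iN))|].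
  by rewrite -mulrBl -natrB// subSnn mul1r gtr0_norm.
have : eta <= e / 48.
  rewrite /eta invfM mulrA ler_pdivrMr// ler_peMr//.
    by rewrite divr_ge0// ltW.
  by rewrite ler1n.
by move=> *; lra.
Qed.

Lemma blocks_refine n m : (n <= m)%N -> A m `<=` A n.
Proof.
move=> nm; rewrite -(subnK nm); move: (m - n)%N => p {nm}.
move=> w hw i iN; have [h1 h2] := hw i iN; split => // k j jn.
have p0 r : (0 : R) < (2 ^ r)%:R by rewrite ltr0n expn_gt0.
have -> : j%:R * (tau / (2 ^ n)%:R) =
    (j * 2 ^ p)%N%:R * (tau / (2 ^ (p + n))%:R).
  by rewrite expnD !natrM; field; rewrite !gt_eqF.
by apply: h2; rewrite expnD mulnC leq_mul2l jn orbT.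
Qed.

(** The errors of the increments add up to at most [N eta], a small part of [e]. *)
Lemma walk n w i k : A n w -> (i <= N)%N ->
  `|W (i%:R * tau) w k 0 - h k (i%:R * tau)| <= i%:R * eta.
Proof.
move=> hw; elim: i => [|i IH] iN.
  by rewrite !mul0r W_at0 h0 mxE subrr normr0.
have [/(_ k) h1 _] := hw i iN; have := IH (ltnW iN).
rewrite WincE in h1.
have -> : i.+1%:R * eta = i%:R * eta + eta by rewrite -natr1 mulrDl mul1r.
move: h1; rewrite /c !ler_norml => /andP[a1 a2] /andP[b1 b2].
by apply/andP; split; lra.
Qed.

(** Within a block the path moves little along dyadic points of all levels, so it
moves little at all times by continuity. *)
Lemma tube_of_blocks w : (forall n, A n w) ->
  forall k (s : R), s \in `[0, T] -> `|W s w k 0 - h k s| <= e.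
Proof.
have e_pos := e0; have tau_pos := tau0.
move=> hw k s sT; move: (sT); rewrite in_itv/= => /andP[s0 sT'].
have [i is1 is2] := grid_cell tau0 s0.
have NT : N%:R * tau = T by rewrite /tau mulrC divfK// gt_eqF.
have Neta : N%:R * eta = e / 48.
  by rewrite /eta; field; rewrite gt_eqF.
have iN : (i <= N)%N.
  by rewrite -(ler_nat R) -(ler_pM2r tau0) NT; exact: le_trans sT'.
have hi := walk k (hw 0%N) iN.
have i_eta : i%:R * eta <= e / 48.
  by rewrite -Neta ler_pM2r// ler_nat.
have osc : `|h k (i%:R * tau) - h k s| <= e / 48.
  apply: hdl => //; first exact: mesh_in.
  by rewrite distrC ger0_norm ?subr_ge0// (le_trans _ tau_dl)// lerBlDl ltW.
(* the right end point [T] begins no block *)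
have [iN'|Ni] := ltnP i N; last first.
  have siN : s = i%:R * tau.
    apply/eqP; rewrite eq_le is1 andbT.
    have -> : i = N by apply/eqP; rewrite eqn_leq iN Ni.
    by rewrite NT.
  by rewrite [in leLHS]siN; lra.
have /cvgrPdist_le/(_ (e / 4)) := @W_continuous R w k s.
rewrite divr_gt0// => /(_ isT)/nbhs_ballP[/= r r0 hr].
(* a level whose grid is finer than the modulus of continuity at [s] *)
pose n := (Num.trunc (tau / r)).+1.
have n1 : tau / r < (2 ^ n)%:R.
  apply: lt_trans (truncnS_gt (tau / r)) _.
  by rewrite ltr_nat -/n ltn_expl.
have p0 : (0 : R) < (2 ^ n)%:R by rewrite ltr0n expn_gt0.
have step_r : tau / (2 ^ n)%:R < r.
  by rewrite ltr_pdivrMr// mulrC -ltr_pdivrMr.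
set de := tau / (2 ^ n)%:R in step_r.
have de0 : 0 < de by exact: divr_gt0.
have si0 : 0 <= s - i%:R * tau by rewrite subr_ge0.
have [j j1 j2] := grid_cell de0 si0.
have jn : (j <= 2 ^ n)%N.
  rewrite -(ler_nat R) -(ler_pM2r de0).
  have -> : (2 ^ n)%:R * de = tau by rewrite /de mulrC divfK// gt_eqF.
  lra.
have [_ /(_ k j jn)] := hw n i iN'; rewrite -/de WincE.
have : `|W s w k 0 - W (i%:R * tau + j%:R * de) w k 0| <= e / 4.
  apply: hr; change (`|s - (i%:R * tau + j%:R * de)| < r).
  by rewrite ger0_norm; lra.
move: hi osc; rewrite !ler_norml.
move=> /andP[? ?] /andP[? ?] /andP[? ?] /andP[? ?].
by apply/andP; split; lra.
Qed.

Lemma measurable_blocks n : measurable (A n).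
Proof.
rewrite (_ : A n = \bigcap_(i in [set i | (i < N)%N])
  block tau eta (e / 8) (c i) i n).
  apply: bigcap_measurableType => i _.
  apply: sig_measurable; last exact: block_sig.
  by move=> l k; exact: measurable_Winc.
by apply/seteqP; split.
Qed.

Hypothesis tail_half : tail_bound (e / 8) tau <= 1 / 2.

Let q := ball_bound eta (e / 24) tau ^+ 2 - 4 * tail_bound (e / 8) tau.

Lemma blocks_prob n : 0 <= q -> ((q ^+ N)%:E <= P (A n))%E.
Proof.
move=> q0.
have M0 : (0 < 2 ^ n)%N by rewrite expn_gt0.
have de0 : 0 < tau / (2 ^ n)%:R by rewrite divr_gt0// ltr0n.
have ht : {homo (fun l : nat => l%:R * (tau / (2 ^ n)%:R)) :
    l m / (l < m)%N >-> l < m}.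
  by move=> l m lm; rewrite ltr_pM2r// ltr_nat.
apply: (@block_product _ _ _ _ _ _ (Winc_independent hP ht) (2 ^ n)%N) => //.
- by move=> l k; exact: measurable_Winc.
- by move=> i iN; exact: block_sig.
- move=> i iN; apply: block_prob => //; first by rewrite divr_ge0// ltW.
  by move=> k; exact: step_small.
Qed.

End Path.

(** The good events of level [n] decrease with [n] and their probabilities have a
positive lower bound that does not depend on [n]. *)
Lemma wiener_tube (T e : R) (h : 'I_2 -> R -> R) : 0 < T -> 0 < e ->
  (forall k, {within `[0, T], continuous (h k)}) -> (forall k, h k 0 = 0) ->
  exists U : set (wiener_space R), [/\ measurable U, (0 < P U)%E &
    forall w, U w -> forall k (s : R), s \in `[0, T] -> `|W s w k 0 - h k s| <= e].
Proof.
move=> T0 e0 ch h0.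
have e48 : 0 < e / 48 by exact: divr_gt0.
have [d0 d00 hd0] := heine_cantor (ch 0) e48.
have [d1 d10 hd1] := heine_cantor (ch 1) e48.
pose dl := Num.min d0 d1; have dl0 : 0 < dl by rewrite lt_min d00.
have hdl k (s r : R) : s \in `[0, T] -> r \in `[0, T] ->
    `|s - r| <= dl -> `|h k s - h k r| <= e / 48.
  move=> sT rT; rewrite /dl le_min => /andP[? ?].
  by case: (ord2P k) => ->; [exact: hd0|exact: hd1].
have [N N0 [taudl half ball]] := fine_mesh e0 T0 dl0.
set tau := T / N%:R in taudl half ball; set eta := e / (48 * N%:R) in ball.
pose c (i : nat) k := h k (i.+1%:R * tau) - h k (i%:R * tau).
pose A n := [set w | forall i, (i < N)%N ->
  block tau eta (e / 8) (c i) i n w].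
have mA n : measurable (A n) by exact: measurable_blocks.
have mU : measurable (\bigcap_n A n) by exact: bigcapT_measurable.
pose q := ball_bound eta (e / 24) tau ^+ 2 - 4 * tail_bound (e / 8) tau.
have q0 : 0 < q by rewrite subr_gt0.
exists (\bigcap_n A n); split => //; last first.
  by move=> w Aw; apply: (tube_of_blocks T0 e0 N0 h0 hdl taudl) => n; exact: Aw.
have cvgA : P (A n) @[n --> \oo] --> P (\bigcap_n A n).
  apply: nonincreasing_cvg_mu => //.
    by rewrite -ge0_fin_numE//; exact: fin_num_measure.
  by move=> n m nm; apply/subsetPset; exact: blocks_refine.
apply: (@lt_le_trans _ _ (q ^+ N)%:E); first by rewrite lte_fin exprn_gt0.
rewrite -(cvg_lim _ cvgA)//; apply: lime_ge.
  by apply/cvg_ex; exists (P (\bigcap_n A n)).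
apply: nearW => n; exact: (blocks_prob T0 e0 N0 hdl taudl half n (ltW q0)).
Qed.

End TubePositive.

(** * Essential bounds and the theorem *)

Section EssentialBounds.
Context d (T : measurableType d) (R : realType) (P : probability T R).
Local Open Scope ereal_scope.

(** An event of positive probability is not contained in a negligible set, so it
meets every property that holds almost everywhere. *)
Let charged_meets (U : set T) (Q : T -> Prop) :
  measurable U -> 0 < P U -> (\forall w \ae P, Q w) -> exists2 w, U w & Q w.
Proof.
move=> mU PU [N [mN PN hN]].
apply: contrapT => h.
have UN : U `<=` N.
  by move=> w Uw; apply: hN => Qw; apply: h; exists w.
by move: PU; rewrite ltNge -PN le_measure ?inE.
Qed.

Lemma ess_sup_ge_on (U : set T) (f : T -> \bar R) (x : \bar R) :
  measurable U -> 0 < P U -> (forall w, U w -> x <= f w) -> x <= ess_sup P f.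
Proof.
move=> mU PU xf; apply: le_ereal_inf_tmp => y hy.
have [w Uw fy] := charged_meets mU PU hy.
exact: le_trans (xf w Uw) fy.
Qed.

Lemma ess_inf_le_on (U : set T) (f : T -> \bar R) (x : \bar R) :
  measurable U -> 0 < P U -> (forall w, U w -> f w <= x) -> ess_inf P f <= x.
Proof.
move=> mU PU xf; apply: ge_ereal_sup => y hy.
have [w Uw fy] := charged_meets mU PU hy.
exact: le_trans fy (xf w Uw).
Qed.

Lemma ereal_unbounded_above (x : \bar R) : (forall A : R, A%:E <= x) -> x = +oo.
Proof.
case: x => [r| |] h //; last by have := h 0%R.
by exfalso; have := h (r + 1)%R; rewrite lee_fin; lra.
Qed.

Lemma ereal_unbounded_below (x : \bar R) : (forall A : R, x <= A%:E) -> x = -oo.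
Proof.
case: x => [r| |] h //; last by have := h 0%R.
by exfalso; have := h (r - 1)%R; rewrite lee_fin; lra.
Qed.

End EssentialBounds.

Section Assembly.
Variables (R : realType) (al be a b sigma : R).
Variables (P : probability (wiener_space R) R)
  (phi : R -> wiener_space R -> 'cV[R]_2 -> 'cV[R]_2).
Hypotheses (ha : 0 < 2 * a) (hb : 2 * a < b) (hsigma : sigma != 0).
Hypotheses (hP : two_sided_wiener P)
  (hphi : is_solution_flow al be a b sigma phi).
Variable z : 'cV[R]_2.

(** The path [sigma W] plays the role of the forcing. *)
Lemma solution_driven (T : R) (w : wiener_space R) : 0 < T ->
  driven_flow al be a b T (fun s => sigma * W s w 0 0)
    (fun s => sigma * W s w 1 0) (fun s Z => phi s w Z).
Proof.
move=> T0.
have start Z : phi 0 w Z = Z.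
  have [_ /(_ 0 (lexx _)) ->] := hphi w Z.
  rewrite W_at0 scaler0 addr0 -[RHS]addr0; congr (_ + _).
  by apply/matrixP => i j; rewrite !mxE set_itv1 Rintegral_set1.
have cphi Z k : {within `[0, T], continuous (fun s => phi s w Z k 0)}.
  have [c _] := hphi w Z.
  have cT : {within `[0, T], continuous (fun s => phi s w Z)}.
    apply: continuous_subspaceW c => s /=.
    by rewrite !in_itv/= andbT => /andP[].
  move=> s; apply: (@cvg_comp _ _ _ (fun s => phi s w Z)
    (fun v : 'cV[R]_2 => v k 0) _ _ _ (cT s)); exact: coord_continuous.
have cW k : {within `[0, T], continuous (fun s => sigma * W s w k 0)}.
  apply/within_continuousZ/continuous_subspaceT; exact: W_continuous.
have cst_cont (x : R) : {within `[0, T], continuous (fun=> x)}.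
  by apply: continuous_subspaceT => s; exact: cvg_cst.
have dphi Z k (g : R -> R) : {within `[0, T], continuous g} ->
    (forall s, drift al be a b (phi s w Z) k 0 = g s) ->
    forall s, s \in `]0, T[ ->
    is_derive s 1 (fun s => phi s w Z k 0 - sigma * W s w k 0) (g s).
  move=> cg gE s sT; have [_ dI] := within_integral_derive T0 cg.
  have dIs := dI s sT.
  have dZ : is_derive s 1 (fun s => Z k 0 +
      \int[lebesgue_measure]_(t in `[0, s]) g t) (g s).
    by apply: is_derive_eq; rewrite add0r mul1r.
  apply: near_eq_is_derive dZ.
  move: sT; rewrite in_itv/= => /andP[s0 _].
  near=> r; have r0 : 0 <= r by apply: ltW; near: r; exact: lt_nbhsr.
  have [_ /(_ r r0) ->] := hphi w Z.
  rewrite !mxE addrK; congr (_ + _).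
  by apply: eq_Rintegral => t _; rewrite gE.
split => // Z; split => //.
- move=> s; apply: (dphi Z 0
    (fun s => drift_x al be a b (phi s w Z 0 0) (phi s w Z 1 0))); last first.
    by move=> r; exact: drift_xE.
  have c0 := cphi Z 0; have c1 := cphi Z 1.
  rewrite /drift_x; apply: within_continuousB.
    by apply: within_continuousB; apply: within_continuousZ.
  apply: within_continuousM.
    by apply: within_continuousD; apply: within_continuousM.
  by apply: within_continuousB; apply: within_continuousZ.
- move=> s; apply: (dphi Z 1
    (fun s => drift_y al be a b (phi s w Z 0 0) (phi s w Z 1 0))); last first.
    by move=> r; exact: drift_yE.
  have c0 := cphi Z 0; have c1 := cphi Z 1.
  rewrite /drift_y; apply: within_continuousB.
    by apply: within_continuousD; apply: within_continuousZ.
  apply: within_continuousM.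
    by apply: within_continuousD; apply: within_continuousM.
  by apply: within_continuousD; apply: within_continuousZ.
Unshelve. all: by end_near. Qed.

(** The eigenvector [(b, - a - kap)] of [S], normalised; [kap] may have either
sign. *)
Lemma eigenpair (kap : R) : kap ^+ 2 = a ^+ 2 + b ^+ 2 ->
  exists mu nu, [/\ mu ^+ 2 + nu ^+ 2 = 1,
    3 * a * mu + b * nu = - (- 2 * a + kap) * mu &
    b * mu + a * nu = - (- 2 * a + kap) * nu].
Proof.
move=> kap2.
have b0 : 0 < b by have := ha; have := hb; lra.
pose m := Num.sqrt (b ^+ 2 + (a + kap) ^+ 2).
have m2 : m ^+ 2 = b ^+ 2 + (a + kap) ^+ 2.
  by rewrite sqr_sqrtr// addr_ge0 ?sqr_ge0.
have m0 : m != 0.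
  by rewrite sqrtr_eq0 -ltNge ltr_wpDr ?sqr_ge0// exprn_gt0.
exists (b / m), (- (a + kap) / m); split.
- by rewrite !expr_div_n sqrrN -mulrDl -m2 divff// expf_neq0.
- by field.
- have b2 : b ^+ 2 = kap ^+ 2 - a ^+ 2 by rewrite kap2; ring.
  have -> : b * (b / m) + a * (- (a + kap) / m) = (b ^+ 2 - a * (a + kap)) / m.
    by field.
  by rewrite b2; field.
Qed.

(** [r^2 T + r k T^2 + k^2 T^3 / 4] is [T (r + k T / 2)^2], so the last factor is
at least [k^2 T^3 / 12] for every [r]. *)
Lemma amplitude (T lam B : R) : 0 < T -> lam != 0 ->
  exists k, forall r : R,
  B <= `|lam| * (r ^+ 2 * T + r * k * T ^+ 2 + k ^+ 2 / 3 * T ^+ 3).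
Proof.
move=> T0 l0; have l1 : 0 < `|lam| by rewrite normr_gt0.
have T3 : 0 < T ^+ 3 by exact: exprn_gt0.
pose q := 12 * `|B| / (`|lam| * T ^+ 3).
have q0 : 0 <= q by rewrite divr_ge0 ?mulr_ge0// ltW.
exists (Num.sqrt q) => r.
have qE : Num.sqrt q ^+ 2 = q by rewrite sqr_sqrtr.
have B1 : B <= `|lam| * (q / 12 * T ^+ 3).
  rewrite [leRHS](_ : _ = `|B|) ?ler_norm// /q.
  by field; rewrite !gt_eqF.
apply: le_trans B1 _; rewrite ler_wpM2l//.
move: (Num.sqrt q) qE => k <-.
have := mulr_ge0 (ltW T0) (sqr_ge0 (r + k * T / 2)).
rewrite !exprS expr0 !mulr1; lra.
Qed.

(** Two-sided control of the exponent up to [ln 2]: the same statement serves the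
supremum and the infimum, and the lower bound keeps the argument of the
logarithm positive. *)
Lemma exponents_charged (T kap k0 : R) : 0 < T -> kap ^+ 2 = a ^+ 2 + b ^+ 2 ->
  exists r (U : set (wiener_space R)) (v : 'cV[R]_2),
  [/\ measurable U, (0 < P U)%E, enorm v = 1 &
    forall w, U w -> `|T * ftle phi T w z v -
      (al * T + (- 2 * a + kap) * (r ^+ 2 * T + r * k0 * T ^+ 2
          + k0 ^+ 2 / 3 * T ^+ 3))| <= ln 2].
Proof.
move=> T0 kap2; have [mu [nu [munu e0 e1]]] := eigenpair kap2.
have a0 : 0 < a by have := ha; lra.
have [r [m0 [m1 [p [q [u [w]]]]]]] := reference_path al be T0 z k0 munu e0 e1.
case=> pq [m00 m10 p0 q0] [cu cw] [du dw] [n0 nT].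
set E := al * T + _ in nT *.
pose v : 'cV[R]_2 := \col_i (if i == 0 then u 0 else w 0).
have v0 : u 0 = v 0 0 by rewrite mxE.
have v1 : w 0 = v 1 0 by rewrite mxE.
have eta0 : 0 < expR E ^+ 2 / 4 by rewrite divr_gt0// exprn_gt0// expR_gt0.
have [e ep close] :=
  differential_near_reference a0 T0 eta0 pq p0 q0 cu cw du dw v0 v1.
have s2 : 0 < sigma ^+ 2 by rewrite exprn_even_gt0.
pose d := Num.sqrt (e / (2 * sigma ^+ 2)).
have d2 : d ^+ 2 = e / (2 * sigma ^+ 2).
  by rewrite sqr_sqrtr// divr_ge0 ?(ltW ep)// mulr_ge0// sqr_ge0.
have d0 : 0 < d by rewrite sqrtr_gt0 divr_gt0// mulr_gt0.
pose h (k : 'I_2) (s : R) := sigma^-1 * (if k == 0 then m0 s else m1 s).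
have ch k : {within `[0, T], continuous (h k)}.
  case: (ord2P k) => ->; apply: within_continuousZ.
    exact: driven_cn0 pq.
  exact: driven_cn1 pq.
have h0 k : h k 0 = 0.
  by rewrite /h; case: ifP => _; rewrite ?m00 ?m10 mulr0.
have [U [mU PU hU]] := wiener_tube hP T0 d0 ch h0.
exists r, U, v; split => //.
  by rewrite /enorm -v0 -v1 n0 sqrtr1.
move=> om Uom.
have hflow := solution_driven om T0.
have := close _ _ _ hflow _ _ _.
rewrite W_at0 !mxE !mulr0 m00 m10 => /(_ erefl erefl).
have noise s : s \in `[0, T] -> (sigma * W s om 0 0 - m0 s) ^+ 2
    + (sigma * W s om 1 0 - m1 s) ^+ 2 <= e.
  move=> sT; have := hU om Uom 0 s sT; have := hU om Uom 1 s sT.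
  rewrite /h /=.
  have bnd x y : `|x - sigma^-1 * y| <= d -> (sigma * x - y) ^+ 2 <= e / 2.
    move=> xy.
    have -> : (sigma * x - y) ^+ 2 = sigma ^+ 2 * (x - sigma^-1 * y) ^+ 2.
      by rewrite -exprMn mulrBr mulVKf.
    have : (x - sigma^-1 * y) ^+ 2 <= d ^+ 2.
      by rewrite -real_normK ?num_real// ler_pXn2r ?nnegrE// ltW.
    rewrite d2 => /(ler_wpM2l (ltW s2)) /le_trans; apply.
    by rewrite le_eqVlt; apply/orP; left; apply/eqP; field.
  move=> /bnd b1 /bnd b0; lra.
move=> /(_ noise).
set D0 := 'd (phi T om) z v 0 0; set D1 := 'd (phi T om) z v 1 0 => hD.
have g0 := expR_gt0 E.
set g := expR E in nT hD g0.
have enormE : enorm ('d (phi T om) z v) = Num.sqrt (D0 ^+ 2 + D1 ^+ 2) by [].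
set n := enorm _ in enormE.
have n2 : n ^+ 2 = D0 ^+ 2 + D1 ^+ 2.
  by rewrite enormE sqr_sqrtr// addr_ge0 ?sqr_ge0.
have nn : 0 <= n by rewrite enormE sqrtr_ge0.
have cs := dot_sqr_le D0 D1 (u T) (w T).
rewrite -n2 nT in cs.
(* Cauchy-Schwarz turns closeness of vectors into closeness of norms *)
have dot_le : D0 * u T + D1 * w T <= n * g.
  rewrite -exprMn in cs.
  apply: le_trans (ler_norm _) _.
  by rewrite -(ler_pXn2r (n := 2))// ?nnegrE ?mulr_ge0 ?(ltW g0)//
    real_normK ?num_real.
have ng : (n - g) ^+ 2 <= g ^+ 2 / 4 by move: hD; nra.
have lower : g / 2 <= n by nra.
have upper : n <= 2 * g by nra.
have n0' : 0 < n by apply: lt_le_trans lower; exact: divr_gt0.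
rewrite /ftle mulrA divff ?gt_eqF// mul1r -/n.
have lnE : ln g = E by rewrite /g expRK.
have l1 : E - ln 2 <= ln n.
  by rewrite -lnE -ln_div ?posrE// ler_ln ?posrE// divr_gt0.
have l2 : ln n <= ln 2 + E.
  by rewrite -lnE -lnM ?posrE// ler_ln ?posrE// mulr_gt0.
by rewrite -/E ler_norml; apply/andP; split; lra.
Qed.

End Assembly.

Theorem theoremF (R : realType) (alpha beta a b sigma : R)
    (P : probability (wiener_space R) R)
    (phi : R -> wiener_space R -> 'cV[R]_2 -> 'cV[R]_2)
    (ha : 0 < 2 * a) (hb : 2 * a < b) (hsigma : sigma != 0)
    (hP : two_sided_wiener P)
    (hphi : is_solution_flow alpha beta a b sigma phi)
    (z : 'cV[R]_2) :
  exists T : R, 0 < T /\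
    forall t : R, 0 < t <= T ->
      ess_sup P (fun w => ereal_sup
        [set (ftle phi t w z v)%:E | v in [set v | enorm v = 1]]) = +oo%E
      /\
      ess_inf P (fun w => ereal_inf
        [set (ftle phi t w z v)%:E | v in [set v | enorm v = 1]]) = -oo%E.
Proof.
(* every positive time works *)
exists 1; split => // t /andP[t0 _].
pose kap := Num.sqrt (a ^+ 2 + b ^+ 2).
have ab0 : 0 <= a ^+ 2 + b ^+ 2 by rewrite addr_ge0 ?sqr_ge0.
have kap2 : kap ^+ 2 = a ^+ 2 + b ^+ 2 by rewrite sqr_sqrtr.
have kap0 : 0 <= kap by rewrite sqrtr_ge0.
have b2 : (2 * a) ^+ 2 < b ^+ 2.
  by rewrite ltr_pXn2r// nnegrE ltW// (lt_trans ha).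
have grow : 0 < - 2 * a + kap.
  have : (2 * a) ^+ 2 < kap ^+ 2 by rewrite kap2; have := sqr_ge0 a; lra.
  rewrite ltr_pXn2r ?nnegrE ?(ltW ha)//; lra.
have decay : - 2 * a - kap < 0 by lra.
split.
- apply: ereal_unbounded_above => A.
  have [k hk] := @amplitude R t (- 2 * a + kap) (A * t - alpha * t + ln 2) t0
    (lt0r_neq0 grow).
  have [r [U [v [mU PU v1 hU]]]] :=
    exponents_charged ha hb hsigma hP hphi z k t0 kap2.
  apply: (ess_sup_ge_on mU PU) => w Uw.
  apply: (@le_trans _ _ (ftle phi t w z v)%:E); last first.
    by apply: ereal_sup_ubound; exists v.
  rewrite lee_fin -(ler_pM2l t0) mulrC.
  have := hU w Uw; have := hk r; rewrite (gtr0_norm grow) ler_norml.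
  set Q := (_ * _) in hU *; move=> h1 /andP[h2 _]; lra.
- apply: ereal_unbounded_below => A.
  have [k hk] := @amplitude R t (- 2 * a - kap) (alpha * t - A * t + ln 2) t0
    (ltr0_neq0 decay).
  have kapN : (- kap) ^+ 2 = a ^+ 2 + b ^+ 2 by rewrite sqrrN.
  have [r [U [v [mU PU v1 hU]]]] :=
    exponents_charged ha hb hsigma hP hphi z k t0 kapN.
  apply: (ess_inf_le_on mU PU) => w Uw.
  apply: (@le_trans _ _ (ftle phi t w z v)%:E).
    by apply: ereal_inf_lbound; exists v.
  rewrite lee_fin -(ler_pM2l t0) (mulrC t A).
  have := hU w Uw; have := hk r; rewrite (ltr0_norm decay) mulNr ler_norml.
  move=> h1 /andP[_ h2]; lra.
Qed.
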